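(* Let $(E,C)$ be an adaptable separated graph. Then the associated inverse semigroup $S(E,C)$ is $E^*$-unitary; that is, for every $s\in S(E,C)$ and every nonzero idempotent $e$ of $S(E,C)$, if $e\le s$ (i.e. $e=es$) then $s$ is idempotent.
   Context: **Adaptable separated graphs.** $\mathbb N=\{1,2,\dots\}$. For a directed graph $E=(E^0,E^1,s,r)$, paths are $e_1\cdots e_n$ with $r(e_i)=s(e_{i+1})$; vertices are paths of length $0$. A separated graph $(E,C)$ is a directed graph $E$ with $C=\bigsqcup_{v\in E^0}C_v$, where $C_v$ is a partition of $s^{-1}(v)$ into nonempty subsets ($C_v=\emptyset$ if $v$ is a sink). It is finitely separated if all sets in $C$ are finite. Put $v\le w$ if there is a path from $w$ to $v$; let $(I,\le)$ be the antisymmetrization of $(E^0,\le)$, whose elements are the transitive components. A finitely separated graph $(E,C)$ is adaptable if $I$ is finite and there are a partition $I=I_{free}\sqcup I_{reg}$ and subgraphs $(E_p)_{p\in I}$, with $E_p^0$ the vertex set of the component $p$, such that: (1) $E^0=\bigsqcup_p E_p^0$; $E_p$ is a transitive (any two vertices joined by a directed path) row-finite graph if $p\in I_{reg}$; $E_p^0=\{v^p\}$ if $p\in I_{free}$. (2) For $p\in I_{reg}$, $w\in E_p^0$: $|C_w|=1$, $|s_{E_p}^{-1}(w)|\ge 2$, and every edge with source $w$ lies in $E_p$ or has range in $E_q^0$ with $q<p$. (3) For $p\in I_{free}$: $s^{-1}(v^p)=\emptyset$ iff $p$ is minimal in $I$ (then put $k(p)=0$). If $p$ is not minimal, $C_{v^p}=\{X_1^{(p)},\dots,X_{k(p)}^{(p)}\}$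 is finite with $X_i^{(p)}=\{\alpha(p,i),\beta(p,i,1),\dots,\beta(p,i,g(p,i))\}$, $g(p,i)\ge1$, $\alpha(p,i)$ a loop at $v^p$, $r(\beta(p,i,t))\in E_q^0$ with $q<p$; and $E_p^1=\{\alpha(p,1),\dots,\alpha(p,k(p))\}$. **The inverse semigroup $S(E,C)$.** It is the $*$-semigroup with $0$ ($*$-semigroup: $s^{**}=s$, $(st)^*=t^*s^*$) generated by $E^0\cup E^1\cup\{(t_i^v)^{\pm1}: i\in\mathbb N,v\in E^0\}$ with relations: (R1) $vw=\delta_{v,w}v$, $v^*=v$ for $v,w\in E^0$; (R2) $e=s(e)e=er(e)$ for $e\in E^1$, and $e^*f=\delta_{e,f}r(e)$ for $e,f$ in the same set $X\in C$; (R3) for $p\in I_{free}$, $i\ne j$: $\alpha(p,i)\alpha(p,j)=\alpha(p,j)\alpha(p,i)$, $\alpha(p,i)\alpha(p,j)^*=\alpha(p,j)^*\alpha(p,i)$; (R4) for $p\in I_{free}$: $\beta(p,i,s)^*\beta(p,j,t)=0$ if $(i,s)\neq(j,t)$; (R5) for each $v$ the elements $(t_i^v)^{\pm1}$ commute mutually, $vt_i^v=t_i^v=t_i^vv$, $t_i^v(t_i^v)^{-1}=v=(t_i^v)^{-1}t_i^v$, $(t_i^v)^*=(t_i^v)^{-1}$; (R6) $t_i^{s(e)}e=e\,t_i^{r(e)}$ if $s(e)\in E_p^0$, $p\in I_{reg}$; (R7) for $p\in I_{free}$: $(t_i^{v^p})^{\pm1}\beta(p,j,s)=\beta(p,j,s)(t^{r(\beta(p,j,s))}_{i+k(p)-1})^{\pm1}$;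 (R8) for $p\in I_{free}$, $i\ne j$: $\alpha(p,i)\beta(p,j,s)=\beta(p,j,s)t^{r(\beta(p,j,s))}_{\sigma_j^p(i)}$ and $\alpha(p,i)^*\beta(p,j,s)=\beta(p,j,s)(t^{r(\beta(p,j,s))}_{\sigma_j^p(i)})^{-1}$, where $\sigma_j^p$ is the increasing bijection $\{1,\dots,k(p)\}\setminus\{j\}\to\{1,\dots,k(p)-1\}$; (R9) for $p\in I_{free}$: $t_i^{v^p}$ commutes with $\alpha(p,j)$ and $\alpha(p,j)^*$. It is known that $S(E,C)$ is an inverse semigroup. *)

(* Defs.v *)
From HB Require Import structures.
From mathcomp Require Import all_boot generic_quotient.
From mathcomp Require Import boolp classical_sets functions cardinality.

Set Implicit Arguments.
Unset Strict Implicit.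
Unset Printing Implicit Defensive.

Local Open Scope classical_set_scope.
Local Open Scope quotient_scope.

(** * Directed graphs and separated graphs *)

Record digraph := Digraph {
  vertex : Type;
  edge : Type;
  src : edge -> vertex;
  rng : edge -> vertex
}.

Record subgraph (E : digraph) := Subgraph {
  sub_vertex : set (vertex E);
  sub_edge : set (edge E);
  sub_src : forall e, sub_edge e -> sub_vertex (src e);
  sub_rng : forall e, sub_edge e -> sub_vertex (rng e)
}.

(* [l] is a path from [v] to [w] all of whose edges lie in [D]. *)
Fixpoint is_path (E : digraph) (D : set (edge E)) (v : vertex E)
    (l : seq (edge E)) (w : vertex E) : Prop :=
  if l is e :: l' then [/\ D e, src e = v & is_path D (rng e) l' w]
  else v = w.

(* Orientation: v <= w when v can be reached FROM w. *)
Definition vle (E : digraph) (v w : vertex E) : Prop :=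
  exists l, is_path setT w l v.

Definition component_of (E : digraph) (v : vertex E) : set (vertex E) :=
  [set w | vle v w /\ vle w v].

(* The antisymmetrization I of (E^0, <=): its elements are the equivalence
   classes of the preorder [vle], each one being literally its set of
   vertices. *)
Definition components (E : digraph) : set (set (vertex E)) :=
  range (@component_of E).

Definition component (E : digraph) : Type := set_type (@components E).

Definition cle (E : digraph) (p q : component E) : Prop :=
  exists v w, [/\ val p v, val q w & vle v w].

Definition clt (E : digraph) (p q : component E) : Prop := cle p q /\ p <> q.

Definition cminimal (E : digraph) (p : component E) : Prop :=
  forall q, cle q p -> q = p.

Record sepgraph := Sepgraph {
  sep_graph :> digraph;
  blocks : vertex sep_graph -> set (set (edge sep_graph));
  blocks_partition : forall v, partition (blocks v) id [set e | src e = v]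
}.

Definition all_blocks (G : sepgraph) : set (set (edge G)) :=
  \bigcup_v @blocks G v.

Definition finitely_separated (G : sepgraph) : Prop :=
  forall X, @all_blocks G X -> finite_set X.

(** * Adaptable separated graphs *)

(* [nblk], [gnum], [alpha], [beta] are the k(p), g(p,i), alpha(p,i) and
   beta(p,i,t); the indices i and t run over ordinals, hence start at 0.
   For p outside [Ifree] the values of [base], [nblk], [gnum], [alpha] and
   [beta] are irrelevant.
   The injectivity fields say that X_1, ..., X_k(p) and, for fixed i,
   beta(p,i,1), ..., beta(p,i,g(p,i)) are enumerations without repetition. *)
Record adaptable (G : sepgraph) := Adaptable {
  ad_finsep : finitely_separated G;
  ad_fincomp : finite_set (@components G);

  Ifree : set (component G);
  Ireg : set (component G);
  ad_IU : Ifree `|` Ireg = setT;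
  ad_II : Ifree `&` Ireg = set0;

  comp_graph : component G -> subgraph G;
  ad_sub_vertex : forall p, sub_vertex (comp_graph p) = val p;
  ad_partition :
    partition [set: component G] (fun p => sub_vertex (comp_graph p)) setT;

  ad_reg_transitive : forall p, Ireg p ->
    forall v w, sub_vertex (comp_graph p) v -> sub_vertex (comp_graph p) w ->
    exists l, is_path (sub_edge (comp_graph p)) v l w;
  ad_reg_rowfinite : forall p, Ireg p ->
    forall w, sub_vertex (comp_graph p) w ->
    finite_set [set e | sub_edge (comp_graph p) e /\ src e = w];
  ad_reg_blocks : forall p, Ireg p ->
    forall w, sub_vertex (comp_graph p) w -> (blocks w #= `I_1)%card;
  ad_reg_two : forall p, Ireg p ->
    forall w, sub_vertex (comp_graph p) w ->
    (`I_2 #<= [set e | sub_edge (comp_graph p) e /\ src e = w])%card;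
  ad_reg_edges : forall p, Ireg p ->
    forall e, sub_vertex (comp_graph p) (src e) ->
    sub_edge (comp_graph p) e \/
    (exists q, clt q p /\ sub_vertex (comp_graph q) (rng e));

  base : component G -> vertex G;
  ad_base : forall p, Ifree p -> sub_vertex (comp_graph p) = [set base p];
  ad_free_sink : forall p, Ifree p ->
    [set e | src e = base p] = set0 <-> cminimal p;

  nblk : component G -> nat;
  gnum : forall p, 'I_(nblk p) -> nat;
  alpha : forall p, 'I_(nblk p) -> edge G;
  beta : forall p (i : 'I_(nblk p)), 'I_(gnum i) -> edge G;
  blk := fun p (i : 'I_(nblk p)) => [set alpha i] `|` range (@beta p i);

  ad_nblk0 : forall p, Ifree p -> cminimal p -> nblk p = 0;
  ad_free_blocks : forall p, Ifree p -> ~ cminimal p ->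
    blocks (base p) = range (@blk p);
  ad_blk_inj : forall p, Ifree p -> ~ cminimal p -> injective (@blk p);
  ad_gnum : forall p, Ifree p -> ~ cminimal p ->
    forall i : 'I_(nblk p), 1 <= gnum i;
  ad_beta_inj : forall p, Ifree p -> ~ cminimal p ->
    forall i : 'I_(nblk p), injective (@beta p i);
  ad_alpha_loop : forall p, Ifree p -> ~ cminimal p ->
    forall i : 'I_(nblk p), src (alpha i) = base p /\ rng (alpha i) = base p;
  ad_beta_rng : forall p, Ifree p -> ~ cminimal p ->
    forall (i : 'I_(nblk p)) (t : 'I_(gnum i)),
    exists q, clt q p /\ sub_vertex (comp_graph q) (rng (beta t));
  ad_free_edges : forall p, Ifree p -> ~ cminimal p ->
    sub_edge (comp_graph p) = range (@alpha p)
}.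

(** * The semigroup S(E,C) *)

Inductive sign := Plus | Minus.

(* [Tg Plus i v] is t_(i+1)^v and [Tg Minus i v] is its formal inverse: the
   index set {1, 2, ...} is shifted down to {0, 1, ...}. *)
Inductive term (G : digraph) : Type :=
| Vx of vertex G
| Ed of edge G
| Tg of sign & nat & vertex G
| Zero
| Star of term G
| Mul of term G & term G.

Arguments Zero {G}.

Declare Scope term_scope.
Delimit Scope term_scope with term.
Local Notation "x ** y" := (Mul x y)
  (at level 40, left associativity) : term_scope.
Local Open Scope term_scope.

(* With 0-based indices, t_(i+k(p)-1) (1-based) is [Tg _ (i + nblk p).-1 _],
   and the increasing bijection sigma_j^p from the indices other than j onto
   {0, ..., nblk p - 2} is [unbump j]. *)
Inductive relation (G : sepgraph) (A : adaptable G) : term G -> term G -> Prop :=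
| R1_idem (v : vertex G) : relation A (Vx v ** Vx v) (Vx v)
| R1_orth (v w : vertex G) : v <> w -> relation A (Vx v ** Vx w) Zero
| R1_star (v : vertex G) : relation A (Star (Vx v)) (Vx v)
| R2_src (e : edge G) : relation A (Ed e) (Vx (src e) ** Ed e)
| R2_rng (e : edge G) : relation A (Ed e) (Ed e ** Vx (rng e))
| R2_same (X : set (edge G)) (e : edge G) :
    all_blocks X -> X e -> relation A (Star (Ed e) ** Ed e) (Vx (rng e))
| R2_diff (X : set (edge G)) (e f : edge G) :
    all_blocks X -> X e -> X f -> e <> f ->
    relation A (Star (Ed e) ** Ed f) Zero
| R3_comm p (i j : 'I_(nblk A p)) : Ifree A p -> i <> j ->
    relation A (Ed (alpha i) ** Ed (alpha j)) (Ed (alpha j) ** Ed (alpha i))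
| R3_comm_star p (i j : 'I_(nblk A p)) : Ifree A p -> i <> j ->
    relation A (Ed (alpha i) ** Star (Ed (alpha j)))
               (Star (Ed (alpha j)) ** Ed (alpha i))
| R4 p (i j : 'I_(nblk A p)) (s : 'I_(gnum i)) (t : 'I_(gnum j)) :
    Ifree A p -> (i : nat, s : nat) <> (j : nat, t : nat) ->
    relation A (Star (Ed (beta s)) ** Ed (beta t)) Zero
| R5_comm (v : vertex G) (i j : nat) (eps del : sign) :
    relation A (Tg eps i v ** Tg del j v) (Tg del j v ** Tg eps i v)
| R5_left (v : vertex G) (i : nat) :
    relation A (Vx v ** Tg Plus i v) (Tg Plus i v)
| R5_right (v : vertex G) (i : nat) :
    relation A (Tg Plus i v ** Vx v) (Tg Plus i v)
| R5_inv_right (v : vertex G) (i : nat) :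
    relation A (Tg Plus i v ** Tg Minus i v) (Vx v)
| R5_inv_left (v : vertex G) (i : nat) :
    relation A (Tg Minus i v ** Tg Plus i v) (Vx v)
| R5_star (v : vertex G) (i : nat) :
    relation A (Star (Tg Plus i v)) (Tg Minus i v)
| R6 p (e : edge G) (i : nat) : Ireg A p -> sub_vertex (comp_graph A p) (src e) ->
    relation A (Tg Plus i (src e) ** Ed e) (Ed e ** Tg Plus i (rng e))
| R7 p (j : 'I_(nblk A p)) (s : 'I_(gnum j)) (i : nat) (eps : sign) :
    Ifree A p ->
    relation A (Tg eps i (base A p) ** Ed (beta s))
               (Ed (beta s) ** Tg eps (i + nblk A p).-1 (rng (beta s)))
| R8 p (i j : 'I_(nblk A p)) (s : 'I_(gnum j)) : Ifree A p -> i <> j ->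
    relation A (Ed (alpha i) ** Ed (beta s))
               (Ed (beta s) ** Tg Plus (unbump j i) (rng (beta s)))
| R8_star p (i j : 'I_(nblk A p)) (s : 'I_(gnum j)) : Ifree A p -> i <> j ->
    relation A (Star (Ed (alpha i)) ** Ed (beta s))
               (Ed (beta s) ** Tg Minus (unbump j i) (rng (beta s)))
| R9 p (j : 'I_(nblk A p)) (i : nat) : Ifree A p ->
    relation A (Tg Plus i (base A p) ** Ed (alpha j))
               (Ed (alpha j) ** Tg Plus i (base A p))
| R9_star p (j : 'I_(nblk A p)) (i : nat) : Ifree A p ->
    relation A (Tg Plus i (base A p) ** Star (Ed (alpha j)))
               (Star (Ed (alpha j)) ** Tg Plus i (base A p)).

(* The least congruence on terms containing [relation A] whose quotient is a
   *-semigroup with 0. *)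
Inductive congr (G : sepgraph) (A : adaptable G) : term G -> term G -> Prop :=
| congr_rel x y : relation A x y -> congr A x y
| congr_refl x : congr A x x
| congr_sym x y : congr A x y -> congr A y x
| congr_trans y x z : congr A x y -> congr A y z -> congr A x z
| congr_mul x x' y y' :
    congr A x x' -> congr A y y' -> congr A (x ** y) (x' ** y')
| congr_star x x' : congr A x x' -> congr A (Star x) (Star x')
| congr_assoc x y z : congr A (x ** (y ** z)) (x ** y ** z)
| congr_0mul x : congr A (Zero ** x) Zero
| congr_mul0 x : congr A (x ** Zero) Zero
| congr_starK x : congr A (Star (Star x)) x
| congr_starM x y : congr A (Star (x ** y)) (Star y ** Star x).

Definition congrb (G : sepgraph) (A : adaptable G) : rel {classic term G} :=
  fun x y => `[< congr A x y >].

Lemma congrb_equiv (G : sepgraph) (A : adaptable G) :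
  equiv_class_of (congrb A).
Proof.
split=> [x|x y|y x z].
- exact/asboolP/congr_refl.
- by apply/asboolP/asboolP; apply: congr_sym.
- by move=> /asboolP xy /asboolP yz; apply/asboolP/(congr_trans xy yz).
Qed.

Canonical congr_equiv (G : sepgraph) (A : adaptable G) :=
  EquivRelPack (congrb_equiv A).

Definition SEC (G : sepgraph) (A : adaptable G) : Type :=
  {eq_quot congr_equiv A}.

HB.instance Definition _ (G : sepgraph) (A : adaptable G) :=
  Choice.on (SEC A).

Definition cls (G : sepgraph) (A : adaptable G) (x : term G) : SEC A :=
  \pi_{eq_quot congr_equiv A} x.

Definition rep (G : sepgraph) (A : adaptable G) (a : SEC A) : term G :=
  repr (a : {eq_quot congr_equiv A}).

Lemma cls_eq (G : sepgraph) (A : adaptable G) (x y : term G) :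
  cls A x = cls A y <-> congr A x y.
Proof. by split=> [/eqmodP/asboolP|xy] //; apply/eqmodP/asboolP. Qed.

Lemma repK (G : sepgraph) (A : adaptable G) (a : SEC A) : cls A (rep a) = a.
Proof. exact: reprK. Qed.

Lemma rep_cls (G : sepgraph) (A : adaptable G) (x : term G) :
  congr A (rep (cls A x)) x.
Proof. by apply/cls_eq; rewrite repK. Qed.

Definition Szero (G : sepgraph) (A : adaptable G) : SEC A := cls A Zero.

Definition Sstar (G : sepgraph) (A : adaptable G) (a : SEC A) : SEC A :=
  cls A (Star (rep a)).

Definition Smul (G : sepgraph) (A : adaptable G) (a b : SEC A) : SEC A :=
  cls A (rep a ** rep b).

Lemma Smul_cls (G : sepgraph) (A : adaptable G) (x y : term G) :
  Smul (cls A x) (cls A y) = cls A (x ** y).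
Proof. by apply/cls_eq/congr_mul; apply: rep_cls. Qed.

Lemma Sstar_cls (G : sepgraph) (A : adaptable G) (x : term G) :
  Sstar (cls A x) = cls A (Star x).
Proof. by apply/cls_eq/congr_star/rep_cls. Qed.

Lemma SmulA (G : sepgraph) (A : adaptable G) : associative (@Smul G A).
Proof.
move=> a b c; rewrite -(repK a) -(repK b) -(repK c) !Smul_cls.
exact/cls_eq/congr_assoc.
Qed.

HB.instance Definition _ (G : sepgraph) (A : adaptable G) :=
  isSemigroup.Build (SEC A) (@SmulA G A).

Lemma mulg_cls (G : sepgraph) (A : adaptable G) (x y : term G) :
  (cls A x * cls A y)%g = cls A (x ** y).
Proof. exact: Smul_cls. Qed.

(** * E*-unitary semigroups *)

(* [zero] is meant to be the zero of the inverse semigroup [M]; the natural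
   order e <= s, for e idempotent, is spelled out as e = e s. *)
Definition Estar_unitary (M : semigroupType) (zero : M) : Prop :=
  forall s e : M,
    (e * e = e)%g -> e <> zero -> (e = e * s)%g -> (s * s = s)%g.

(* Main.v *)
(* Positive words in the edges and the t's act on walks: sequences of non-loop
   edges, each remembering how often the loop of its block has been run at its
   source, ending at a vertex with one integer coordinate per alpha and per t.
   Edges prepend steps, while alpha's and t's shift coordinates, a shift being
   passed along a step beta(p,j,t) as the relations (R7) and (R8) prescribe.
   Interpreting the star as the converse relation, S(E,C) acts on walks by
   partial injections.

   Every nonzero element is x y^* with x, y positive words of the same range,
   so that it acts with nonempty domain.  If 0 <> e = e s, the action of s
   therefore fixes some walk; writing s = x y^*, some walk w has x w = y w.
   Reading off the steps and coordinates of x w gives a normal form of x, whence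
   x = y in S(E,C), and s = x x^* is idempotent. *)
From HB Require Import structures.
From mathcomp Require Import all_boot ssralg ssrnum ssrint zify.
From mathcomp Require Import boolp classical_sets cardinality.
Require Import Defs.

Set Implicit Arguments.
Unset Strict Implicit.
Unset Printing Implicit Defensive.

Import GRing.Theory.

(** * Edges of an adaptable separated graph *)

(** The index is a bare [nat], so that edges at different vertices can be compared without dependent
    types; the source of the edge recovers the component. *)
Inductive kind := Loop of nat | Exit of nat | Plain.

Section Adaptable.
Context (G : sepgraph) (A : adaptable G).
Implicit Types (v w : vertex G) (e f : edge G) (p q : component G).

Lemma component_inj p q v :
  sub_vertex (comp_graph A p) v -> sub_vertex (comp_graph A q) v -> p = q.
Proof.
move=> pv qv; have [_ tr _] := ad_partition A.
by apply: tr => //; exists v.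
Qed.

Lemma component_ex v : exists p, sub_vertex (comp_graph A p) v.
Proof.
have [cov _ _] := ad_partition A.
have : [set: vertex G]%classic v by [].
by rewrite -cov => -[p _ pv]; exists p.
Qed.

Definition comp_of v : component G := projT1 (cid (component_ex v)).

Lemma comp_ofP v : sub_vertex (comp_graph A (comp_of v)) v.
Proof. exact: projT2 (cid (component_ex v)). Qed.

Lemma base_sub p : Ifree A p -> sub_vertex (comp_graph A p) (base A p).
Proof. by move=> pF; rewrite ad_base. Qed.

Lemma comp_of_base p : Ifree A p -> comp_of (base A p) = p.
Proof. by move=> pF; apply: component_inj (comp_ofP _) (base_sub pF). Qed.

Lemma base_inj p q : Ifree A p -> Ifree A q -> base A p = base A q -> p = q.
Proof. by move=> pF qF e; rewrite -(comp_of_base pF) e comp_of_base. Qed.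

Lemma free_reg p q v : Ifree A p -> Ireg A q ->
  sub_vertex (comp_graph A p) v -> sub_vertex (comp_graph A q) v -> False.
Proof.
move=> pF qR pv qv; have pq := component_inj pv qv; rewrite pq in pF.
by have : (Ifree A `&` Ireg A)%classic q by []; rewrite ad_II.
Qed.

Lemma block_ex e : exists2 X, blocks (src e) X & X e.
Proof.
have [cov _ _] := blocks_partition (src e).
have : [set f | src f = src e]%classic e by [].
by rewrite -cov => -[X bX Xe]; exists X.
Qed.

Lemma block_src v X e : blocks v X -> X e -> src e = v.
Proof.
have [cov _ _] := blocks_partition v => bX Xe.
suff : [set f | src f = v]%classic e by [].
by rewrite -cov; exists X.
Qed.

Lemma block_inj v X Y e : blocks v X -> blocks v Y -> X e -> Y e -> X = Y.
Proof.
have [_ tr _] := blocks_partition v => bX bY Xe Ye.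
by apply: tr => //; exists e.
Qed.

Lemma ncminimal p (i : 'I_(nblk A p)) : Ifree A p -> ~ cminimal p.
Proof. by move=> pF /(ad_nblk0 pF) k0; case: i; rewrite k0. Qed.

Lemma blk_block p (i : 'I_(nblk A p)) : Ifree A p -> blocks (base A p) (blk i).
Proof.
by move=> pF; rewrite (ad_free_blocks pF (ncminimal i pF)); exists i.
Qed.

Lemma blk_beta p (i : 'I_(nblk A p)) (t : 'I_(gnum i)) : blk i (beta t).
Proof. by right; exists t. Qed.

Lemma alpha_src p (i : 'I_(nblk A p)) : Ifree A p -> src (alpha i) = base A p.
Proof. by move=> pF; have [] := ad_alpha_loop pF (ncminimal i pF) i. Qed.

Lemma alpha_rng p (i : 'I_(nblk A p)) : Ifree A p -> rng (alpha i) = base A p.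
Proof. by move=> pF; have [] := ad_alpha_loop pF (ncminimal i pF) i. Qed.

Lemma beta_src p (i : 'I_(nblk A p)) (t : 'I_(gnum i)) :
  Ifree A p -> src (beta t) = base A p.
Proof. by move=> pF; apply: block_src (blk_block i pF) (blk_beta t). Qed.

(** A common edge forces a common source, hence p = q, and the partition of the edges at that vertex
    leaves only one block containing it. *)
Lemma blk_index p q (i : 'I_(nblk A p)) (j : 'I_(nblk A q)) e :
  Ifree A p -> Ifree A q -> blk i e -> blk j e -> i = j :> nat.
Proof.
move=> pF qF ie je.
have pq : p = q.
  apply: base_inj => //.
  by rewrite -(block_src (blk_block i pF) ie) (block_src (blk_block j qF) je).
subst q; congr nat_of_ord; apply: (ad_blk_inj pF (ncminimal i pF)).
exact: block_inj (blk_block i pF) (blk_block j pF) ie je.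
Qed.

Lemma beta_rng_base p (i : 'I_(nblk A p)) (t : 'I_(gnum i)) :
  Ifree A p -> rng (beta t) <> base A p.
Proof.
move=> pF rb; have [q [[_ qp] qr]] := ad_beta_rng pF (ncminimal i pF) t.
by apply: qp; apply: component_inj qr _; rewrite rb; apply: base_sub.
Qed.

(** An alpha ends where it starts, while a beta leaves its component. *)
Lemma alpha_beta p q (i : 'I_(nblk A p)) (j : 'I_(nblk A q)) (t : 'I_(gnum j)) :
  Ifree A p -> Ifree A q -> alpha i <> beta t.
Proof.
move=> pF qF ab; apply: (beta_rng_base (t := t)) => //.
by rewrite -ab alpha_rng // -(alpha_src i) // ab beta_src.
Qed.

(** * Loops, exits and plain edges *)

Definition edge_kind e K : Prop :=
  match K with
  | Loop i => exists p (i' : 'I_(nblk A p)),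
      [/\ Ifree A p, e = alpha i' & i = i']
  | Exit j => exists p (j' : 'I_(nblk A p)) (t : 'I_(gnum j')),
      [/\ Ifree A p, e = beta t & j = j']
  | Plain => exists p, Ireg A p /\ sub_vertex (comp_graph A p) (src e)
  end.

Lemma edge_kind_ex e : exists K, edge_kind e K.
Proof.
have [p pe] := component_ex (src e).
have : (Ifree A `|` Ireg A)%classic p by rewrite ad_IU.
case=> [pF|pR]; last by exists Plain, p.
have be : src e = base A p by move: pe; rewrite ad_base.
have ncm : ~ cminimal p.
  move/(ad_free_sink pF) => e0.
  by have : [set f | src f = base A p]%classic e by []; rewrite e0.
have [X] := block_ex e.
rewrite be (ad_free_blocks pF ncm) => -[i _ <-] [->|[t _ <-]].
  by exists (Loop i), p, i.
by exists (Exit i), p, i, t.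
Qed.

Lemma edge_kind_inj e K K' : edge_kind e K -> edge_kind e K' -> K = K'.
Proof.
case: K => [i|j|]; case: K' => [i'|j'|] //=.
- move=> [p [a [pF ea ->]]] [q [b [qF eb ->]]]; congr Loop.
  by apply: (@blk_index p q a b e) => //; [rewrite ea|rewrite eb]; left.
- by move=> [p [a [pF -> _]]] [q [b [t [qF /alpha_beta]]]]; case.
- move=> [p [a [pF -> _]]] [q [qR]]; rewrite alpha_src // => qe.
  by case: (free_reg pF qR _ qe); apply: base_sub.
- by move=> [p [a [t [pF -> _]]]] [q [b [qF /esym/alpha_beta]]]; case.
- move=> [p [a [t [pF ea ->]]]] [q [b [u [qF eb ->]]]]; congr Exit.
  apply: (@blk_index p q a b e) => //; first by rewrite ea; right; exists t.
  by rewrite eb; right; exists u.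
- move=> [p [a [t [pF -> _]]]] [q [qR]]; rewrite beta_src // => qe.
  by case: (free_reg pF qR _ qe); apply: base_sub.
- move=> [q [qR qe]] [p [a [pF ea _]]]; move: qe; rewrite ea alpha_src // => qe.
  by case: (free_reg pF qR _ qe); apply: base_sub.
- move=> [q [qR qe]] [p [a [t [pF ea _]]]].
  move: qe; rewrite ea beta_src // => qe.
  by case: (free_reg pF qR _ qe); apply: base_sub.
Qed.

Definition kind_of e : kind := projT1 (cid (edge_kind_ex e)).

Lemma kind_ofP e : edge_kind e (kind_of e).
Proof. exact: projT2 (cid (edge_kind_ex e)). Qed.

Lemma kind_ofE e K : edge_kind e K -> kind_of e = K.
Proof. exact: edge_kind_inj (kind_ofP e). Qed.

Lemma kind_alpha p (i : 'I_(nblk A p)) :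
  Ifree A p -> kind_of (alpha i) = Loop i.
Proof. by move=> pF; apply/kind_ofE; exists p, i. Qed.

Lemma kind_beta p (j : 'I_(nblk A p)) (t : 'I_(gnum j)) :
  Ifree A p -> kind_of (beta t) = Exit j.
Proof. by move=> pF; apply/kind_ofE; exists p, j, t. Qed.

(** Outside the free components [nblk] is arbitrary; the value 0 there says that a regular vertex
    carries t-coordinates only. *)
Definition nblk_at v : nat :=
  if `[< Ifree A (comp_of v) >] then nblk A (comp_of v) else 0.

Lemma nblk_at_base p : Ifree A p -> nblk_at (base A p) = nblk A p.
Proof. by move=> pF; rewrite /nblk_at comp_of_base // asboolT. Qed.

Lemma nblk_at_reg p v : Ireg A p -> sub_vertex (comp_graph A p) v ->
  nblk_at v = 0.
Proof.
move=> pR pv; rewrite /nblk_at asboolF // => pF.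
exact: free_reg pF pR (comp_ofP v) pv.
Qed.

Definition is_loop e : bool := if kind_of e is Loop _ then true else false.

Lemma kind_of_loop e i : kind_of e = Loop i ->
  exists p (i' : 'I_(nblk A p)), [/\ Ifree A p, e = alpha i' & i = i'].
Proof. by move=> ke; have := kind_ofP e; rewrite ke. Qed.

Lemma kind_of_exit e j : kind_of e = Exit j ->
  exists p (j' : 'I_(nblk A p)) (t : 'I_(gnum j')),
    [/\ Ifree A p, e = beta t & j = j'].
Proof. by move=> ke; have := kind_ofP e; rewrite ke. Qed.

Lemma kind_of_plain e : kind_of e = Plain <->
  exists p, Ireg A p /\ sub_vertex (comp_graph A p) (src e).
Proof.
split=> [ke|ke]; first by have := kind_ofP e; rewrite ke.
exact: kind_ofE.
Qed.

Lemma loop_lt e i : kind_of e = Loop i -> i < nblk_at (src e).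
Proof.
by move=> /kind_of_loop[p [i' [pF -> ->]]]; rewrite alpha_src // nblk_at_base.
Qed.

Lemma exit_lt e j : kind_of e = Exit j -> j < nblk_at (src e).
Proof.
move=> /kind_of_exit[p [j' [t [pF -> ->]]]].
by rewrite beta_src // nblk_at_base.
Qed.

Lemma plain_nblk e : kind_of e = Plain -> nblk_at (src e) = 0.
Proof. by move=> /kind_of_plain[p [pR]]; apply: nblk_at_reg. Qed.

Lemma loop_rng e : is_loop e -> rng e = src e.
Proof.
rewrite /is_loop; case ke: (kind_of e) => [i||] // _.
have [p [i' [pF -> _]]] := kind_of_loop ke.
by rewrite alpha_rng // alpha_src.
Qed.

Lemma loop_inj e f i : kind_of e = Loop i -> kind_of f = Loop i ->
  src e = src f -> e = f.
Proof.
move=> /kind_of_loop[p [i1 [pF -> ->]]] /kind_of_loop[q [i2 [qF -> i12]]].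
rewrite !alpha_src // => /(base_inj pF qF) pq; subst q.
by have -> : i1 = i2 by apply: val_inj.
Qed.

End Adaptable.

(** * The action on walks *)

Inductive walk (E : digraph) :=
| Halt of vertex E & (nat -> int)
| Step of int & edge E & walk E.

Definition start (E : digraph) (w : walk E) : vertex E :=
  match w with Halt v _ => v | Step _ e _ => src e end.

Definition sign_int (s : sign) : int := if s is Plus then 1%R else (- 1)%R.

Definition opp_sign (s : sign) : sign := if s is Plus then Minus else Plus.

Lemma sign_int_opp s : sign_int (opp_sign s) = (- sign_int s)%R.
Proof. by case: s. Qed.

Section Action.
Context (G : sepgraph) (A : adaptable G).
Implicit Types (e f : edge G) (w : walk G) (v : vertex G).

(* The coordinates at a vertex v are indexed by nat: l < nblk_at v stands for
   alpha_l and nblk_at v + i for t_i.  [slot e] is the coordinate at [src e]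
   recorded in a step along e, and [pass e l] is the coordinate at [rng e] onto
   which e moves any other coordinate l. *)
Definition slot e : option nat :=
  if kind_of A e is Exit j then Some j else None.

Definition pass e (l : nat) : nat :=
  nblk_at A (rng e) + (if slot e is Some j then unbump j l else l).

Lemma pass_inj e l l' : slot e != Some l -> slot e != Some l' ->
  pass e l = pass e l' -> l = l'.
Proof.
rewrite /pass => jl jl' /addnI.
case: (slot e) jl jl' => [j|] // jl jl'.
have {}jl : j != l by [].
have {}jl' : j != l' by [].
rewrite /unbump; lia.
Qed.

Lemma pass_ge e l : nblk_at A (rng e) <= pass e l.
Proof. exact: leq_addr. Qed.

(** * Shifts of coordinates *)

Fixpoint shift (l : nat) (z : int) (w : walk G) : walk G :=
  match w with
  | Halt v c => Halt v (fun i => if i == l then (c i + z)%R else c i)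
  | Step a e w' =>
      if slot e == Some l then Step (a + z)%R e w'
      else Step a e (shift (pass e l) z w')
  end.

Lemma shiftC l z l' z' w :
  shift l z (shift l' z' w) = shift l' z' (shift l z w).
Proof.
elim: w l l' => [v c|a e w IH] l l' /=.
  congr Halt; apply/funext => i.
  by case: eqP => // _; case: eqP => // _; rewrite addrAC.
case: (boolP (slot e == Some l)) => /= el;
  case: (boolP (slot e == Some l')) => /= el'.
- by rewrite el addrAC.
- by rewrite el.
- by rewrite (negbTE el).
- by rewrite (negbTE el) IH.
Qed.

Lemma shiftD l z z' w : shift l z (shift l z' w) = shift l (z + z')%R w.
Proof.
elim: w l => [v c|a e w IH] l /=.
  congr Halt; apply/funext => i.
  by case: eqP => // _; rewrite -addrA [(z' + z)%R]addrC.
case: (slot e =P Some l) => [el|/eqP/negbTE el] /=.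
  by rewrite el eqxx -addrA [(z' + z)%R]addrC.
by rewrite el IH.
Qed.

Lemma shift0 l w : shift l 0%R w = w.
Proof.
elim: w l => [v c|a e w IH] l /=.
  by congr Halt; apply/funext => i; case: eqP => // _; rewrite addr0.
by case: eqP => _; rewrite ?addr0 // IH.
Qed.

Lemma shiftK l z w : shift l (- z)%R (shift l z w) = w.
Proof. by rewrite shiftD addNr shift0. Qed.

Lemma shiftNK l z w : shift l z (shift l (- z)%R w) = w.
Proof. by rewrite shiftD addrN shift0. Qed.

Lemma shift_inj l z : injective (shift l z).
Proof. exact: can_inj (shiftK l z). Qed.

Lemma start_shift l z w : start (shift l z w) = start w.
Proof. by case: w => //= a e w; case: ifP. Qed.

(* Nonnegativity of the recorded exponents is what makes the image of
   beta(p,i,t) disjoint from that of alpha(p,i). *)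
Fixpoint valid (w : walk G) : Prop :=
  match w with
  | Halt _ _ => True
  | Step a e w' => [/\ (0 <= a)%R, ~~ is_loop A e, start w' = rng e & valid w']
  end.

Lemma slot_lt e l : slot e = Some l -> l < nblk_at A (src e).
Proof.
rewrite /slot; case ke: (kind_of A e) => [|j|] // -[<-].
exact: exit_lt ke.
Qed.

(** A t-coordinate is never the slot of the first step, and [pass] turns it into a t-coordinate
    again; so no recorded exponent changes, whatever the sign of z. *)
Lemma valid_shift l z w : nblk_at A (start w) <= l -> valid w ->
  valid (shift l z w).
Proof.
elim: w l => //= a e w IH l lk [a0 eL we wv].
case: eqP => [/slot_lt|_ /=]; first by rewrite ltnNge lk.
by split; rewrite ?start_shift //; apply: IH => //; rewrite we pass_ge.
Qed.

Lemma valid_shiftE l z w : nblk_at A (start w) <= l ->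
  valid (shift l z w) <-> valid w.
Proof.
move=> lk; split; last exact: valid_shift.
by move/(@valid_shift l (- z)%R); rewrite start_shift shiftK; apply.
Qed.

(** Only the exponent of the first step can change, and it does not decrease; past that step the
    shift runs on t-coordinates. *)
Lemma valid_shift_ge0 l z w : (0 <= z)%R -> valid w -> valid (shift l z w).
Proof.
move=> z0; case: w => //= a e w [a0 eL we wv]; case: eqP => _ /=.
  by split=> //; apply: Num.Theory.addr_ge0.
by split; rewrite ?start_shift //; apply: valid_shift => //; rewrite we pass_ge.
Qed.

(** Only the first exponent could be negative, and as l and l' differ, one of the two shifts leaves
    it unchanged. *)
Lemma valid_unshift l l' z z' w : l <> l' ->
  valid (shift l z w) -> valid (shift l' z' w) -> valid w.
Proof.
move=> ll'; case: w => //= a e w.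
have E m (x : int) : start w = rng e ->
    valid (shift (pass e m) x w) -> valid w.
  by move=> we; apply: (valid_shiftE _ _).1; rewrite we pass_ge.
case: eqP => [->|_].
  move=> [_ eL we wv]; case: eqP => [[]//|_ [a0 _ _ _]]; split=> //.
case: eqP => [_ [a0 eL + +] _|_ [a0 eL + +] _]; rewrite start_shift => we wv.
  by split=> //; apply: E wv.
by split=> //; apply: E wv.
Qed.

Definition edge_act e w : walk G :=
  if kind_of A e is Loop i then shift i 1%R w else Step 0%R e w.

(** The second walk is the one acted on and the first is the result, so that products compose as
    operators. With relations in place of functions, the star is just the exchange of the two. *)
Fixpoint sem (x : term G) (w' w : walk G) : Prop :=
  match x with
  | Vx v => [/\ valid w, start w = v & w' = w]
  | Ed e => [/\ valid w, start w = rng e & w' = edge_act e w]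
  | Tg s i v =>
      [/\ valid w, start w = v & w' = shift (nblk_at A v + i) (sign_int s) w]
  | Zero => False
  | Star x => sem x w w'
  | Mul x y => exists2 u, sem x w' u & sem y u w
  end.

Lemma edge_act_inj e : injective (edge_act e).
Proof.
rewrite /edge_act => w w'; case: (kind_of A e) => [i||]; first exact: shift_inj.
  by move=> ? [].
by case.
Qed.

Lemma start_edge_act e w : start w = rng e -> start (edge_act e w) = src e.
Proof.
move=> we; have := @loop_rng _ A e; rewrite /is_loop /edge_act.
by case: (kind_of A e) => // i <- //; rewrite start_shift.
Qed.

Lemma valid_edge_act e w : start w = rng e -> valid w -> valid (edge_act e w).
Proof.
move=> we wv; rewrite /edge_act; case ke: (kind_of A e) => [i|j|] /=.
- exact: valid_shift_ge0.
- by split=> //; rewrite /is_loop ke.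
- by split=> //; rewrite /is_loop ke.
Qed.

(* Two edges in the same block either are distinct steps, or one is the loop
   counting passages through the slot of the other. *)
Lemma edge_act_disjoint v (X : set (edge G)) e f w w' : blocks v X ->
  X e -> X f -> e <> f -> valid w -> valid w' ->
  edge_act e w = edge_act f w' -> False.
Proof.
move=> bX Xe Xf; have sef : src e = src f.
  by rewrite (block_src bX Xe) (block_src bX Xf).
have LE e1 f1 i j u u' : X e1 -> X f1 -> kind_of A e1 = Loop i ->
    kind_of A f1 = Exit j -> valid u -> shift i 1%R u = Step 0%R f1 u' -> False.
  move=> Xe1 Xf1 ke kf; have ij : i = j.
    have [p [i' [pF e1E ->]]] := kind_of_loop ke.
    have [q [j' [t [qF f1E ->]]]] := kind_of_exit kf.
    apply: (@blk_index _ A p q i' j' e1); rewrite ?e1E //; first by left.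
    have -> : blk j' = X; last by rewrite -e1E.
    apply: (@block_inj _ (base A q) _ _ f1) => //.
    - exact: blk_block.
    - by rewrite -(beta_src t qF) -f1E (block_src bX Xf1).
    - by rewrite f1E; right; exists t.
  (* A first step with slot i now records at least 1 instead of 0; any other first step would have
     to be [f1], whose slot is i. *)
  case: u => //= a e2 u [a0 _ _ _]; case: eqP => [_ []|e2i []].
    by move=> a1; move: a0; lia.
  by move=> _ e2f; move: e2i; rewrite e2f /slot kf ij.
rewrite /edge_act => ef wv w'v.
case ke: (kind_of A e) => [i|i|]; case kf: (kind_of A f) => [j|j|].
- have ij : i = j.
    have [p [i' [pF eE ->]]] := kind_of_loop ke.
    have [q [j' [qF fE ->]]] := kind_of_loop kf.
    apply: (@blk_index _ A p q i' j' e); rewrite ?eE //; first by left.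
    have -> : blk j' = X; last by rewrite -eE.
    apply: (@block_inj _ (base A q) _ _ f) => //.
    - exact: blk_block.
    - by rewrite -(alpha_src j' qF) -fE (block_src bX Xf).
    - by rewrite fE; left.
  by case: ef; apply: loop_inj ke _ sef; rewrite kf ij.
- exact: LE Xe Xf ke kf wv.
- by have := loop_lt ke; rewrite sef plain_nblk.
- by move=> /esym; apply: LE Xf Xe kf ke w'v.
- by case.
- by case.
- by have := loop_lt kf; rewrite -sef plain_nblk.
- by case.
- by case.
Qed.

Lemma edge_act_alpha p (i : 'I_(nblk A p)) w : Ifree A p ->
  edge_act (alpha i) w = shift i 1%R w.
Proof. by move=> pF; rewrite /edge_act kind_alpha. Qed.

Lemma edge_act_beta p (j : 'I_(nblk A p)) (t : 'I_(gnum j)) w : Ifree A p ->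
  edge_act (beta t) w = Step 0%R (beta t) w.
Proof. by move=> pF; rewrite /edge_act kind_beta. Qed.

(** * Generators acting as shifts *)

Definition shift_rel v l (z : int) w' w : Prop :=
  [/\ valid w, start w = v & w' = shift l z w].

(** Two cases in which a shift keeps walks valid: an alpha moves its coordinate up, a t moves its
    own either way. *)
Definition admissible v l (z : int) : Prop := (0 <= z)%R \/ nblk_at A v <= l.

Lemma admissible_valid v l z w : admissible v l z -> start w = v ->
  valid w -> valid (shift l z w).
Proof.
move=> [z0|lk] ws wv; first exact: valid_shift_ge0.
by apply: valid_shift; rewrite ?ws.
Qed.

Lemma shift_rel_comm v l z l' z' w' w :
  admissible v l z -> admissible v l' z' ->
  (exists2 u, shift_rel v l z w' u & shift_rel v l' z' u w) <->
  (exists2 u, shift_rel v l' z' w' u & shift_rel v l z u w).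
Proof.
move=> lz lz'; split=> -[u [uv us ->] [wv ws ->]].
  exists (shift l z w); split=> //; rewrite ?start_shift //; last exact: shiftC.
  exact: admissible_valid lz _ _.
exists (shift l' z' w); split=> //; rewrite ?start_shift //; last exact: shiftC.
exact: admissible_valid lz' _ _.
Qed.

(** From right to left, a common image of w' and w must yield a common preimage; [valid_unshift]
    makes it valid, which is where the coordinates have to be distinct. *)
Lemma shift_rel_comm_star v l z l' z' w' w : l <> l' ->
  admissible v l z -> admissible v l' z' ->
  (exists2 u, shift_rel v l z w' u & shift_rel v l' z' w u) <->
  (exists2 u, shift_rel v l' z' u w' & shift_rel v l z u w).
Proof.
move=> ll' lz lz'; split=> [[u [uv us ->] [_ _ ->]]|[u [w'v ws' ->] [wv ws e]]].
  exists (shift l z (shift l' z' u)); split; rewrite ?start_shift //.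
  - exact: admissible_valid lz _ _.
  - exact: shiftC.
  - exact: admissible_valid lz' _ _.
have w'E : w' = shift l z (shift l' (- z')%R w) by rewrite shiftC -e shiftK.
have wE : w = shift l' z' (shift l' (- z')%R w) by rewrite shiftNK.
have uv : valid (shift l' (- z')%R w).
  by apply: (@valid_unshift l l' z z' _ ll'); [rewrite -w'E|rewrite -wE].
by exists (shift l' (- z')%R w); split; rewrite ?start_shift.
Qed.

Lemma sem_alpha p (i : 'I_(nblk A p)) : Ifree A p ->
  sem (Ed (alpha i)) = shift_rel (base A p) i 1%R.
Proof.
move=> pF; do 2!apply/funext=> ?.
by rewrite /= alpha_rng // edge_act_alpha.
Qed.

Lemma sem_Tg s i v :
  sem (Tg s i v) = shift_rel v (nblk_at A v + i) (sign_int s).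
Proof. by []. Qed.

Lemma sem_beta p (j : 'I_(nblk A p)) (t : 'I_(gnum j)) w' w : Ifree A p ->
  sem (Ed (beta t)) w' w <->
  [/\ valid w, start w = rng (beta t) & w' = Step 0%R (beta t) w].
Proof. by move=> pF; rewrite /= edge_act_beta. Qed.

Lemma sem_Mul x y w' w :
  sem (Mul x y) w' w = (exists2 u, sem x w' u & sem y u w).
Proof. by []. Qed.

Lemma sem_Star x : sem (Star x) = fun w' w => sem x w w'.
Proof. by []. Qed.

(* The relation [g e = e t'] for a generator [g] acting as a shift that does
   not affect the slot of [e]. *)
Lemma shift_rel_step v l z e w' w : src e = v -> ~~ is_loop A e ->
  slot e != Some l ->
  (exists2 u, shift_rel v l z w' u & sem (Ed e) u w) <->
  (exists2 u, sem (Ed e) w' u & shift_rel (rng e) (pass e l) z u w).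
Proof.
move=> ev eL el; have actE u : edge_act e u = Step 0%R e u.
  by move: eL; rewrite /is_loop /edge_act; case: (kind_of A e).
have step_l u : shift l z (Step 0%R e u) = Step 0%R e (shift (pass e l) z u).
  by rewrite /= (negbTE el).
split=> -[u [uv us ->] [wv ws ->]].
  exists (shift (pass e l) z w); last by [].
  rewrite !actE step_l; split=> //; last by rewrite start_shift.
  by apply: valid_shift => //; rewrite ws pass_ge.
exists (edge_act e w); last by [].
by split; rewrite ?actE ?step_l.
Qed.

(** Past [e] the shift concerns a t-coordinate, where both signs preserve validity; so the converse
    of a shift before [e] becomes the shift by -z after it. *)
Lemma shift_rel_step_inv v l z e w' w : src e = v -> ~~ is_loop A e ->
  slot e != Some l ->
  (exists2 u, shift_rel v l z u w' & sem (Ed e) u w) <->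
  (exists2 u, sem (Ed e) w' u & shift_rel (rng e) (pass e l) (- z)%R u w).
Proof.
move=> ev eL el; have actE u : edge_act e u = Step 0%R e u.
  by move: eL; rewrite /is_loop /edge_act; case: (kind_of A e).
have step_l y u : shift l y (Step 0%R e u) = Step 0%R e (shift (pass e l) y u).
  by rewrite /= (negbTE el).
split=> [[u [w'v ws' ->] [wv ws]]|[u [uv us ->] [wv ws ->]]].
  rewrite actE => /(congr1 (shift l (- z)%R)); rewrite shiftK step_l => ->.
  exists (shift (pass e l) (- z)%R w) => //.
  split; rewrite ?actE ?start_shift //.
  by apply: valid_shift => //; rewrite ws pass_ge.
have sv : valid (shift (pass e l) (- z)%R w).
  by apply: valid_shift => //; rewrite ws pass_ge.
exists (edge_act e w) => //; rewrite !actE; split=> //=.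
- by split; rewrite ?start_shift.
- by rewrite (negbTE el) shiftNK.
Qed.

Lemma shift_sgK l s w :
  shift l (sign_int s) (shift l (sign_int (opp_sign s)) w) = w.
Proof. by rewrite sign_int_opp shiftNK. Qed.

Lemma sem_Tg_inv s i v w' w :
  sem (Mul (Tg s i v) (Tg (opp_sign s) i v)) w' w <-> sem (Vx v) w' w.
Proof.
have sv u l z : valid u -> start u = v -> nblk_at A v <= l ->
    valid (shift l z u).
  by move=> uv us vl; apply: valid_shift; rewrite ?us.
split=> [[u [uv us ->] [wv ws ->]]|[wv ws ->]].
  by split; rewrite ?shift_sgK.
exists (shift (nblk_at A v + i) (sign_int (opp_sign s)) w) => //; split=> //.
- by apply: sv; rewrite ?leq_addr.
- by rewrite start_shift.
- by rewrite shift_sgK.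
Qed.

Lemma slot_beta p (j : 'I_(nblk A p)) (t : 'I_(gnum j)) : Ifree A p ->
  slot (beta t) = Some (j : nat).
Proof. by move=> pF; rewrite /slot kind_beta. Qed.

Lemma loop_beta p (j : 'I_(nblk A p)) (t : 'I_(gnum j)) : Ifree A p ->
  ~~ is_loop A (beta t).
Proof. by move=> pF; rewrite /is_loop kind_beta. Qed.

(** Alphas and t's act as shifts: the commutations in (R3), (R5) and (R9) are those of shifts, and
    (R6) to (R8) pass a shift along a step. Orthogonality in (R2) is disjointness of images, and
    (R4) compares first steps. *)
Lemma sem_relation x y w' w : relation A x y -> sem x w' w <-> sem y w' w.
Proof.
case=> {x y} [v|v u vu|v|e|e|X e|X e f|p i j pF ij|p i j pF ij
  |p i j s t pF ij|v i j eps del|v i|v i|v i|v i|v i|p e i pR pe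
  |p j s i eps pF|p i j s pF ij|p i j s pF ij|p j i pF|p j i pF].
- split=> [[u [uv us ->] [wv ws ->]] //|[wv ws ->]].
  by exists w.
- by split=> // -[x [_ xv _] [_ xu xw]]; apply: vu; rewrite -xv xw.
- by split=> -[wv ws ->].
- split=> [[wv ws ->]|[u [uv us ->] []] //]; exists (edge_act e w) => //.
  by split=> //; [apply: valid_edge_act|apply: start_edge_act].
- by split=> [[wv ws ->]|[u [uv us ->] [wv ws <-]]] //; exists w.
- move=> [v _ bX] Xe; split=> [[u [w'v ws ->] [wv _ /edge_act_inj->]] //|].
  by move=> [wv ws ->]; exists (edge_act e w).
- move=> [v _ bX] Xe Xf ef; split=> // -[u [w'v ws ->] [wv _]].
  exact: edge_act_disjoint bX Xe Xf ef w'v wv.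
- by rewrite !sem_Mul !sem_alpha //; apply: shift_rel_comm; left.
- rewrite !sem_Mul !sem_Star !sem_alpha //.
  apply: shift_rel_comm_star; [|left|left] => //.
  by move/val_inj.
- rewrite sem_Mul sem_Star; split=> // -[u] /sem_beta[]// _ _ ->.
  move=> /sem_beta[]// _ _ [tE _]; have ij' : i = j :> nat.
    by apply: (blk_index pF pF (blk_beta s)); rewrite tE; apply: blk_beta.
  have ijE : i = j by apply: val_inj.
  by subst j; apply: ij; rewrite (ad_beta_inj pF (ncminimal i pF) tE).
- rewrite !sem_Mul !sem_Tg; apply: shift_rel_comm; right; exact: leq_addr.
- split=> [[u [uv us ->]] []//|[wv ws ->]].
  exists (shift (nblk_at A v + i) 1%R w) => //; split=> //.
    by apply: valid_shift; rewrite // ws leq_addr.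
  by rewrite start_shift.
- by split=> [[u [uv us ->] [wv ws ->]]|[wv ws ->]] //; exists w.
- exact: (sem_Tg_inv Plus).
- exact: (sem_Tg_inv Minus).
- rewrite sem_Star; split=> -[uv us ->].
    split; rewrite ?start_shift //; last by rewrite (shift_sgK _ Minus).
    by apply: valid_shift; rewrite // us leq_addr.
  split; rewrite ?start_shift //; last by rewrite (shift_sgK _ Plus).
  by apply: valid_shift; rewrite // us leq_addr.
- rewrite !sem_Mul !sem_Tg (nblk_at_reg pR pe) add0n.
  have ke : kind_of A e = Plain by apply/kind_of_plain; exists p.
  have -> : nblk_at A (rng e) + i = pass e i by rewrite /pass /slot ke.
  by apply: shift_rel_step; rewrite // /slot /is_loop ke.
- rewrite !sem_Mul !sem_Tg nblk_at_base //.
  have jp := ltn_ord j.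
  (* Since j < k(p), removing j lowers the coordinate k(p) + i by one. *)
  have -> : nblk_at A (rng (beta s)) + (i + nblk A p).-1 =
      pass (beta s) (nblk A p + i).
    rewrite /pass slot_beta // /unbump; lia.
  apply: shift_rel_step; rewrite ?beta_src ?loop_beta ?slot_beta //.
  by apply/eqP => -[]; lia.
- rewrite !sem_Mul sem_alpha // sem_Tg.
  have -> : nblk_at A (rng (beta s)) + unbump j i = pass (beta s) i.
    by rewrite /pass slot_beta.
  apply: shift_rel_step; rewrite ?beta_src ?loop_beta ?slot_beta //.
  by apply/eqP => -[] /val_inj ji; apply: ij.
- rewrite !sem_Mul sem_Star sem_alpha // sem_Tg.
  have -> : nblk_at A (rng (beta s)) + unbump j i = pass (beta s) i.
    by rewrite /pass slot_beta.
  apply: shift_rel_step_inv; rewrite ?beta_src ?loop_beta ?slot_beta //.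
  by apply/eqP => -[] /val_inj ji; apply: ij.
- rewrite !sem_Mul sem_alpha // sem_Tg nblk_at_base //.
  apply: shift_rel_comm; last by left.
  by right; rewrite nblk_at_base ?leq_addr.
- rewrite !sem_Mul sem_Star sem_alpha // sem_Tg nblk_at_base //.
  apply: shift_rel_comm_star; [|right|by left].
    have := ltn_ord j; lia.
  by rewrite nblk_at_base ?leq_addr.
Qed.

Lemma sem_sound x y w' w : congr A x y -> sem x w' w <-> sem y w' w.
Proof.
move=> xy; elim: xy w' w => {x y} [x y xy|x|x y _ IH|y x z _ IHx _ IHz
  |x x' y y' _ IHx _ IHy|x x' _ IH|x y z|x|x|x|x y] w' w //=.
- exact: sem_relation.
- exact: iff_sym.
- exact: iff_trans (IHx _ _) (IHz _ _).
- by split=> -[u xu yu]; exists u; by [apply/IHx|apply/IHy].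
- split=> [[u xu [u' yu zu]]|[u' [u xu yu] zu]].
    by exists u' => //; exists u.
  by exists u => //; exists u'.
- by split=> // -[].
- by split=> // -[].
- by split=> -[u]; exists u.
Qed.

End Action.

(** * Relations between generators *)

(** The letters of positive words. Both signs of t are allowed, so only the stars of edges are left
    out. *)
Inductive gen (E : digraph) :=
| GenE of edge E
| GenT of sign & nat & vertex E.

Definition gsrc (E : digraph) (g : gen E) : vertex E :=
  match g with GenE e => src e | GenT _ _ v => v end.

Definition grng (E : digraph) (g : gen E) : vertex E :=
  match g with GenE e => rng e | GenT _ _ v => v end.

Definition gsign (E : digraph) (g : gen E) : sign :=
  if g is GenT s _ _ then s else Plus.

Definition gterm (E : digraph) (g : gen E) : term E :=
  match g with GenE e => Ed e | GenT s i v => Tg s i v end.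

Section Algebra.
Context (G : sepgraph) (A : adaptable G).
Implicit Types (e f : edge G) (v : vertex G) (a b : SEC A) (g : gen G).

Local Open Scope group_scope.
Local Notation "x '^-*'" := (Sstar x) (at level 2, format "x '^-*'").
Local Notation "0" := (cls A Zero).

Local Notation V v := (cls A (Vx v)).
Local Notation E e := (cls A (Ed e)).
Local Notation T s i v := (cls A (Tg s i v)).
Local Notation Gn g := (cls A (gterm g)).

Lemma cls_relation x y : relation A x y -> cls A x = cls A y.
Proof. by move=> xy; apply/cls_eq/congr_rel. Qed.

Lemma starK a : a^-*^-* = a.
Proof. by rewrite -(repK a) !Sstar_cls; apply/cls_eq/congr_starK. Qed.

Lemma starM a b : (a * b)^-* = b^-* * a^-*.
Proof.
rewrite -(repK a) -(repK b) (Sstar_cls A (rep a)) (Sstar_cls A (rep b)).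
rewrite !mulg_cls Sstar_cls.
exact/cls_eq/congr_starM.
Qed.

Lemma mul0s a : 0 * a = 0.
Proof. by rewrite -(repK a) mulg_cls; apply/cls_eq/congr_0mul. Qed.

Lemma muls0 a : a * 0 = 0.
Proof. by rewrite -(repK a) mulg_cls; apply/cls_eq/congr_mul0. Qed.

(** With a the star of 0 one has 0 = 0 a, and taking stars gives a = 0 a = 0. *)
Lemma star0 : 0^-* = 0.
Proof. by rewrite -[in LHS](mul0s 0^-*) starM starK mul0s. Qed.

Lemma V_idem v : V v * V v = V v.
Proof. by rewrite mulg_cls; apply/cls_relation/R1_idem. Qed.

Lemma V_orth v v' : v <> v' -> V v * V v' = 0.
Proof. by move=> vv'; rewrite mulg_cls; apply/cls_relation/R1_orth. Qed.

Lemma star_V v : (V v)^-* = V v.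
Proof. by rewrite Sstar_cls; apply/cls_relation/R1_star. Qed.

Lemma E_src e : V (src e) * E e = E e.
Proof. by rewrite mulg_cls; apply/esym/cls_relation/R2_src. Qed.

Lemma E_rng e : E e * V (rng e) = E e.
Proof. by rewrite mulg_cls; apply/esym/cls_relation/R2_rng. Qed.

Lemma star_E_E e : (E e)^-* * E e = V (rng e).
Proof.
have [X bX Xe] := block_ex e.
rewrite Sstar_cls mulg_cls; apply/cls_relation/(@R2_same _ _ X) => //.
by exists (src e).
Qed.

Lemma star_E_src e : (E e)^-* * V (src e) = (E e)^-*.
Proof. by rewrite -[in RHS]E_src starM star_V. Qed.

Lemma star_E_rng e : V (rng e) * (E e)^-* = (E e)^-*.
Proof. by rewrite -[in RHS]E_rng starM star_V. Qed.

Lemma star_T s i v : (T s i v)^-* = T (opp_sign s) i v.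
Proof.
have st : (T Plus i v)^-* = T Minus i v.
  by rewrite Sstar_cls; apply/cls_relation/R5_star.
by case: s => //=; rewrite -st starK.
Qed.

Lemma T_left s i v : V v * T s i v = T s i v.
Proof.
case: s; first by rewrite mulg_cls; apply/cls_relation/R5_left.
have <- := star_T Plus i v; rewrite -{1}(star_V v) -starM.
by congr (_^-*); rewrite mulg_cls; apply/cls_relation/R5_right.
Qed.

Lemma T_right s i v : T s i v * V v = T s i v.
Proof. by rewrite -[LHS]starK starM star_V star_T T_left star_T; case: s. Qed.

Lemma T_opp s i v : T s i v * T (opp_sign s) i v = V v.
Proof.
case: s; rewrite mulg_cls; apply/cls_relation; first exact: R5_inv_right.
exact: R5_inv_left.
Qed.

Lemma T_oppl s i v : T (opp_sign s) i v * T s i v = V v.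
Proof.
by rewrite -{2}[s](_ : opp_sign (opp_sign s) = s) ?T_opp //; case: s.
Qed.

(** Extends (R6) and (R9), stated for t, to its inverse: multiply by the inverse on both sides. *)
Lemma T_intertwine s i j v v' a : V v * a = a -> a * V v' = a ->
  T s i v * a = a * T s j v' ->
  T (opp_sign s) i v * a = a * T (opp_sign s) j v'.
Proof.
move=> va av' ta.
rewrite -{1}av' -(T_opp s j v') !mulgA -(mulgA _ a) -ta !mulgA T_oppl.
by rewrite va.
Qed.

Lemma Gn_src g : V (gsrc g) * Gn g = Gn g.
Proof. by case: g => [e|s i v]; [apply: E_src|apply: T_left]. Qed.

Lemma Gn_rng g : Gn g * V (grng g) = Gn g.
Proof. by case: g => [e|s i v]; [apply: E_rng|apply: T_right]. Qed.

Lemma star_Gn_Gn g : (Gn g)^-* * Gn g = V (grng g).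
Proof. by case: g => [e|s i v]; rewrite ?star_E_E //= star_T T_oppl. Qed.

(** The coordinate on which [g] acts as a shift; [None] marks the letters that prepend a step. *)
Definition gidx g : option nat :=
  match g with
  | GenE e => if kind_of A e is Loop i then Some i else None
  | GenT _ i v => Some (nblk_at A v + i)
  end.

(** [pass e l] without its offset: the index of the t at [rng e] into which coordinate l turns. *)
Definition push e l : nat := if slot A e is Some j then unbump j l else l.

Lemma Gn_comm g g' : gidx g -> gidx g' -> gsrc g = gsrc g' ->
  Gn g * Gn g' = Gn g' * Gn g.
Proof.
have TA s i v e : gidx (GenE e) -> src e = v -> T s i v * E e = E e * T s i v.
  rewrite /=; case ke: (kind_of A e) => [l||] // _.
  have [p [l' [pF -> _]]] := kind_of_loop ke; rewrite alpha_src // => <-.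
  have TP : T Plus i (base A p) * E (alpha l') =
      E (alpha l') * T Plus i (base A p).
    by rewrite !mulg_cls; apply/cls_relation/R9.
  case: s => //; apply: (@T_intertwine Plus) TP.
    by rewrite -(alpha_src l') // E_src.
  by rewrite -(alpha_rng l') // E_rng.
case: g g' => [e|s i v] [f|s' i' v'] ge gf.
- move: ge gf => /=; case ke: (kind_of A e) => [l||] // _.
  case kf: (kind_of A f) => [l'||] // _.
  have [p [i [pF -> _]]] := kind_of_loop ke.
  have [q [j [qF -> _]]] := kind_of_loop kf.
  rewrite !alpha_src // => /(base_inj pF qF) pq; subst q.
  case: (eqVneq i j) => [->//|/eqP ij].
  by rewrite !mulg_cls; apply/cls_relation/R3_comm.
- by move=> /= sv; rewrite (TA s' i' v' e).
- by move=> /= sv; rewrite (TA s i v f).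
- by move=> /= ->; rewrite !mulg_cls; apply/cls_relation/R5_comm.
Qed.

(** Collects (R6), (R7) and (R8): the algebraic counterpart of passing a shift along a step. *)
Lemma push_star g e l : gidx g = Some l -> gsrc g = src e -> ~~ is_loop A e ->
  slot A e != Some l ->
  Gn g * E e = E e * T (gsign g) (push e l) (rng e) /\
  (Gn g)^-* * E e = E e * T (opp_sign (gsign g)) (push e l) (rng e).
Proof.
rewrite /is_loop /slot /push; case: g => [f|s i v] /=.
  case kf: (kind_of A f) => [l'||] // [<-] fe eL el {l}.
  have [p [i [pF fE l'E]]] := kind_of_loop kf.
  case ke: (kind_of A e) eL el => [|j|] // _ el; last first.
    by have := loop_lt kf; rewrite fe plain_nblk.
  have [q [j' [t [qF eE jE]]]] := kind_of_exit ke.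
  have pq : p = q.
    by apply: (base_inj pF qF); rewrite -(alpha_src i) // -fE fe eE beta_src.
  subst q; rewrite /slot ke fE eE l'E jE.
  have ij : i <> j' by move=> ij; move: el; rewrite l'E jE ij eqxx.
  rewrite !Sstar_cls !mulg_cls.
  by split; apply/cls_relation; [apply: R8|apply: R8_star].
suff TE s' : nblk_at A v + i = l -> v = src e ->
    (if kind_of A e is Loop _ then true else false) = false ->
    T s' i v * E e = E e * T s' (push e l) (rng e).
  move=> [lE] ve /negbTE eL el; split; first exact: TE.
  by rewrite star_T; apply: TE.
rewrite /push /slot => <- -> {v l}; case ke: (kind_of A e) => [//|j|] _.
  have [p [j' [t [pF eE jE]]]] := kind_of_exit ke.
  rewrite eE jE beta_src // nblk_at_base //.
  have -> : unbump j' (nblk A p + i) = (i + nblk A p).-1.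
    rewrite /unbump; have := ltn_ord j'; lia.
  by rewrite !mulg_cls; apply/cls_relation/R7.
have [p [pR pe]] := (kind_of_plain A e).1 ke.
rewrite (plain_nblk ke) add0n.
have TP : T Plus i (src e) * E e = E e * T Plus i (rng e).
  by rewrite !mulg_cls; apply/cls_relation/(@R6 _ _ p).
by case: s' => //; apply: (@T_intertwine Plus); rewrite ?E_src ?E_rng.
Qed.

Lemma star_E_block v X e f : blocks v X -> X e -> X f -> e <> f ->
  (E e)^-* * E f = 0.
Proof.
move=> bX Xe Xf ef; rewrite Sstar_cls mulg_cls.
by apply/cls_relation/(@R2_diff _ _ X) => //; exists v.
Qed.

Lemma star_E_loop_exit e f i : kind_of A e = Loop i -> kind_of A f = Exit i ->
  src e = src f -> (E e)^-* * E f = 0 /\ (E f)^-* * E e = 0.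
Proof.
move=> /kind_of_loop[p [i1 [pF eE i1E]]].
move=> /kind_of_exit[q [i2 [t [qF fE i2E]]]] ef.
have pq : p = q.
  by apply: (base_inj pF qF); rewrite -(alpha_src i1) // -eE ef fE beta_src.
subst q; have ii : i1 = i2 by apply: val_inj; rewrite /= -i1E.
subst i2; have b1 := blk_block i1 pF.
split; apply: (star_E_block b1); rewrite ?eE ?fE; try by left.
- by right; exists t.
- exact: alpha_beta.
- by right; exists t.
- by move/esym; apply: alpha_beta.
Qed.

(** At a free vertex this is (R4), which also covers distinct blocks; a regular vertex has a single
    block, so (R2) applies. *)
Lemma star_E_step e f : ~~ is_loop A e -> ~~ is_loop A f -> src e = src f ->
  e <> f -> (E e)^-* * E f = 0.
Proof.
rewrite /is_loop; case ke: (kind_of A e) => [//|j|] _;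
  case kf: (kind_of A f) => [//|j'|] _ sef ef.
- have [p [i [t [pF eE _]]]] := kind_of_exit ke.
  have [q [i' [t' [qF fE _]]]] := kind_of_exit kf.
  have pq : p = q.
    by apply: (base_inj pF qF); rewrite -(beta_src t) // -eE sef fE beta_src.
  subst q; rewrite eE fE Sstar_cls mulg_cls; apply/cls_relation/R4 => // -[].
  move=> /val_inj ii; subst i' => /val_inj tt; subst t'.
  by apply: ef; rewrite eE fE.
- by have := exit_lt ke; rewrite sef plain_nblk.
- by have := exit_lt kf; rewrite -sef plain_nblk.
- have [p [pR pe]] := (kind_of_plain A e).1 ke.
  have /card_set_bijP := ad_reg_blocks pR pe; move=> [h [hfun hinj _]].
  have [X bX Xe] := block_ex e; have [Y bY Yf] := block_ex f.
  rewrite -sef in bY.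
  suff XY : X = Y by apply: (star_E_block bX) => //; rewrite XY.
  have hX := hfun _ bX; have hY := hfun _ bY.
  apply: hinj; rewrite ?inE //.
  by move: hX hY; rewrite /= !ltnS !leqn0 => /eqP-> /eqP->.
Qed.

(** The starred halves of (R3) and (R9). The letter [e] itself is excluded, since there the product
    collapses to a vertex. *)
Lemma star_loop_comm e i g l : kind_of A e = Loop i -> gidx g = Some l ->
  gsrc g = src e -> g <> GenE e -> (E e)^-* * Gn g = Gn g * (E e)^-*.
Proof.
move=> ke; have [p [i1 [pF eE _]]] := kind_of_loop ke.
case: g => [f|s m v] /=.
  case kf: (kind_of A f) => [j||] // _ fe fne.
  have [q [j1 [qF fE _]]] := kind_of_loop kf.
  have pq : p = q.
    by apply: (base_inj pF qF); rewrite -(alpha_src i1) // -eE -fe fE alpha_src.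
  subst q; rewrite eE fE Sstar_cls !mulg_cls; apply/esym/cls_relation.
  apply: R3_comm_star => // ji; apply: fne.
  by rewrite eE fE ji.
move=> _ -> _.
have st : src e = rng e by rewrite (@loop_rng _ A) // /is_loop ke.
have TP : T Plus m (src e) * (E e)^-* = (E e)^-* * T Plus m (src e).
  rewrite eE alpha_src // Sstar_cls !mulg_cls; exact/cls_relation/R9_star.
case: s => //; apply/esym/(@T_intertwine Plus) => //.
  by rewrite st star_E_rng.
by rewrite star_E_src.
Qed.

(** Drives stars of edges to the right through a positive word: the product vanishes, cancels, lets
    the star pass, or, when a loop meets an exit of another block, turns the star into a t. *)
Lemma star_E_Gn e g : gsrc g = src e ->
  [\/ (E e)^-* * Gn g = 0, g = GenE e,
      exists2 g', gsrc g' = rng e /\ grng g' = rng e &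
        (E e)^-* * Gn g = Gn g' * (E e)^-* /\ grng g = src e |
      exists2 g', gsrc g' = grng g /\ grng g' = grng g &
        (E e)^-* * Gn g = Gn g * Gn g'].
Proof.
move=> ge; case: (pselect (g = GenE e)) => [|gne]; first by constructor 2.
case gl: (gidx g) => [l|]; last first.
  case: g gl ge gne => //= f; case kf: (kind_of A f) => [//|j|] _ fe fne.
    have fL : ~~ is_loop A f by rewrite /is_loop kf.
    case eL : (is_loop A e); last first.
      constructor 1; apply: star_E_step; rewrite ?eL //.
      by move=> ef; apply: fne; rewrite ef.
    move: eL; rewrite /is_loop; case ke: (kind_of A e) => [i||] // _.
    case: (eqVneq j i) => [ji|ji].
      constructor 1; rewrite ji in kf.
      by have [] := star_E_loop_exit ke kf (esym fe).
    constructor 4; exists (GenT Minus (push f i) (rng f)) => //.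
    have gi : gidx (GenE e) = Some i by rewrite /= ke.
    have el : slot A f != Some i.
      by rewrite /slot kf; apply/eqP => -[/eqP]; rewrite (negbTE ji).
    by have [_ ->] := push_star gi (esym fe) fL el.
  constructor 1; apply: star_E_step; rewrite /is_loop ?kf //.
    case ke: (kind_of A e) => [i||] //.
    by have := loop_lt ke; rewrite -fe plain_nblk.
  by move=> ef; apply: fne; rewrite ef.
have gr : grng g = src e.
  case: g gl ge gne => //= f; case kf: (kind_of A f) => [i||] // _ <- _.
  by rewrite (@loop_rng _ A) // /is_loop kf.
case eL : (is_loop A e).
  constructor 3; exists g; first by rewrite gr ge (@loop_rng _ A).
  move: eL; rewrite /is_loop; case ke: (kind_of A e) => [i||] // _.
  by rewrite (star_loop_comm ke gl).
case: (eqVneq (slot A e) (Some l)) => [el|el].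
  constructor 1; move: (el); rewrite /slot.
  case ke: (kind_of A e) => [|j|] // -[jl].
  case: g gl ge gne {gr} => [f|s i v] /=.
    case kf: (kind_of A f) => [i||] // [il] fe _.
    by rewrite il -jl in kf; have [] := star_E_loop_exit kf ke fe.
  by move=> [vl] ve; have := exit_lt ke; rewrite jl -vl ve; lia.
constructor 3; exists (GenT (gsign g) (push e l) (rng e)) => //; split=> //=.
(* The product at hand is the star of [(Gn g)^-* * E e]. *)
have [_ gE] := push_star gl ge (negbT eL) el.
by rewrite -[LHS]starK starM starK gE starM star_T; case: (gsign g).
Qed.

End Algebra.

(** * Factorization into positive words *)

HB.instance Definition _ (E : digraph) := gen_eqMixin (gen E).

Section Words.
Context (G : sepgraph) (A : adaptable G).
Implicit Types (e f : edge G) (u v : vertex G) (a b : SEC A) (g : gen G).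
Implicit Types (x y : seq (gen G)) (w : walk G).

Local Open Scope group_scope.
Local Notation "x '^-*'" := (Sstar x) (at level 2, format "x '^-*'").
Local Notation "0" := (cls A Zero).
Local Notation V v := (cls A (Vx v)).
Local Notation E e := (cls A (Ed e)).
Local Notation T s i v := (cls A (Tg s i v)).
Local Notation Gn g := (cls A (gterm g)).

(** * Composable words and their values *)

Definition wsrc x u : vertex G := if x is g :: _ then gsrc g else u.

Fixpoint chain x u : Prop :=
  if x is g :: x' then grng g = wsrc x' u /\ chain x' u else True.

Definition prefix_mul x a : SEC A := foldr (fun g b => Gn g * b) a x.

(** The factor at the end gives a value to the empty word, namely the vertex u. *)
Definition word x u : SEC A := prefix_mul x (V u).

Lemma prefix_mulA x a b : prefix_mul x (a * b) = prefix_mul x a * b.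
Proof. by elim: x => //= g x ->; rewrite mulgA. Qed.

Lemma word_cat x y u : word (x ++ y) u = prefix_mul x (word y u).
Proof. by rewrite /word /prefix_mul foldr_cat. Qed.

Lemma word_cons g x u : word (g :: x) u = Gn g * word x u.
Proof. by []. Qed.

Lemma word_src x u : V (wsrc x u) * word x u = word x u.
Proof. by case: x => [|g x]; [apply: V_idem|rewrite /= mulgA Gn_src]. Qed.

Lemma Gn_word0 g x u : grng g <> wsrc x u -> Gn g * word x u = 0.
Proof.
move=> gx; rewrite -word_src -(Gn_rng A g) -mulgA (mulgA (V _) (V _)) V_orth //.
by rewrite mul0s muls0.
Qed.

Lemma word_rng x u : word x u * V u = word x u.
Proof. by rewrite -prefix_mulA V_idem. Qed.

Lemma star_word_word x u : chain x u -> (word x u)^-* * word x u = V u.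
Proof.
elim: x => [_|g x IH [gx xu]]; first by rewrite /word /= star_V V_idem.
rewrite word_cons starM mulgA -(mulgA _ _ (Gn g)) star_Gn_Gn gx.
by rewrite -mulgA word_src IH.
Qed.

Lemma word_star_idem x u : chain x u ->
  word x u * (word x u)^-* * (word x u * (word x u)^-*) =
  word x u * (word x u)^-*.
Proof.
by move=> xu; rewrite mulgA -(mulgA _ _ (word x u)) star_word_word // word_rng.
Qed.

(** * Elements of the form x y^* *)

Definition split_form a : Prop := a = 0 \/
  exists x y u, [/\ chain x u, chain y u & a = word x u * (word y u)^-*].

Lemma split_word x u : chain x u -> split_form (word x u).
Proof.
move=> xu; right; exists x, [::], u; split=> //.
by rewrite /word /= star_V word_rng.
Qed.

Lemma split_star a : split_form a -> split_form (a^-*).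
Proof.
move=> [->|[x [y [u [xu yu ->]]]]]; first by left; apply: star0.
by right; exists y, x, u; split; rewrite // starM starK.
Qed.

Lemma split_V v a : split_form a -> split_form (V v * a).
Proof.
move=> [->|[x [y [u [xu yu ->]]]]]; first by left; apply: muls0.
case: (pselect (v = wsrc x u)) => [->|vx].
  by right; exists x, y, u; split; rewrite // mulgA word_src.
by left; rewrite -word_src !mulgA V_orth // !mul0s.
Qed.

Lemma split_Gn g a : split_form a -> split_form (Gn g * a).
Proof.
move=> [->|[x [y [u [xu yu ->]]]]]; first by left; apply: muls0.
case: (pselect (grng g = wsrc x u)) => [gx|gx].
  by right; exists (g :: x), y, u; split; rewrite // word_cons mulgA.
by left; rewrite mulgA Gn_word0 // mul0s.
Qed.

(** Passing to stars turns right multiplication by a starred word into left multiplication by its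
    letters. *)
Lemma split_mul_star_word a x u :
  split_form a -> split_form (a * (word x u)^-*).
Proof.
move=> aS; elim: x => [|g x IH].
  rewrite -[a]starK -starM; apply: split_star.
  by apply: split_V; apply: split_star.
rewrite word_cons starM mulgA -[_ * _]starK starM starK; apply: split_star.
by apply: split_Gn; apply: split_star.
Qed.

(** Induction along the word by [star_E_Gn]; once the star is absorbed into a t, what remains is
    already positive. *)
Lemma split_star_E_word e x u : chain x u -> split_form ((E e)^-* * word x u).
Proof.
elim: x => [_|g x IH [gx xu]].
  case: (pselect (u = src e)) => [->|ue].
    rewrite /word /= star_E_src; apply: split_star.
    by rewrite -E_rng; apply: (@split_word [:: GenE e]).
  by left; rewrite -star_E_src -mulgA V_orth ?muls0 // => /esym.
rewrite word_cons; case: (pselect (gsrc g = src e)) => [ge|ge]; last first.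
  left; rewrite mulgA -star_E_src -(Gn_src A g) -(mulgA _ (V _)).
  by rewrite (mulgA (V _) (V _)) V_orth ?mul0s ?muls0 ?mul0s // => /esym.
rewrite mulgA.
have [-> | gE | [g' _ [-> _]] | [g' [g's g'r] ->]] := star_E_Gn A ge.
- by left; rewrite mul0s.
- move: gx; rewrite gE /= star_E_E => ->; rewrite word_src; exact: split_word.
- by rewrite -mulgA; apply: split_Gn; apply: IH.
- rewrite -mulgA; apply: split_Gn; apply: (@split_word (g' :: x)).
  by split=> //; rewrite g'r gx.
Qed.

Lemma split_star_E e a : split_form a -> split_form ((E e)^-* * a).
Proof.
move=> [->|[x [y [u [xu yu ->]]]]]; first by left; apply: muls0.
by rewrite mulgA; apply/split_mul_star_word/split_star_E_word.
Qed.

(** Closure under products is not evident from the form, so the induction carries along left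
    multiplication by the term and by its star. *)
Lemma split_form_term (t : term G) : split_form (cls A t) /\
  forall a, split_form a ->
    split_form (cls A t * a) /\ split_form ((cls A t)^-* * a).
Proof.
elim: t => [v|e|s i v||t [tS tI]|t [tS tI] t' [t'S t'I]].
- split; first exact: (@split_word [::]).
  by move=> a aS; rewrite star_V; split; apply: split_V.
- split; first by rewrite -E_rng; apply: (@split_word [:: GenE e]).
  by move=> a aS; split; [apply: (@split_Gn (GenE e))|apply: split_star_E].
- split; first by rewrite -T_right; apply: (@split_word [:: GenT s i v]).
  move=> a aS; rewrite star_T.
  split; first exact: (@split_Gn (GenT s i v)).
  exact: (@split_Gn (GenT (opp_sign s) i v)).
- by split; [left|move=> a _; split; left; rewrite ?star0 mul0s].
- rewrite -Sstar_cls; split; first exact: split_star.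
  by move=> a aS; rewrite starK; have [] := tI _ aS.
- rewrite -mulg_cls; split; first by have [] := tI _ t'S.
  move=> a aS; rewrite starM -!mulgA; split.
    by have [] := tI _ (t'I _ aS).1.
  by have [] := t'I _ (tI _ aS).2.
Qed.

Lemma split_formP a : split_form a.
Proof. by rewrite -(repK a); have [] := split_form_term (rep a). Qed.

(** * The action of elements of S(E,C) *)

Definition ssem a w' w : Prop := sem A (rep a) w' w.

Lemma ssem_cls (t : term G) w' w : ssem (cls A t) w' w <-> sem A t w' w.
Proof. exact/sem_sound/rep_cls. Qed.

Lemma ssem_mul a b w' w : ssem (a * b) w' w <->
  exists2 z, ssem a w' z & ssem b z w.
Proof. by rewrite -{1}(repK a) -{1}(repK b) mulg_cls ssem_cls. Qed.

Lemma ssem_star a w' w : ssem a^-* w' w <-> ssem a w w'.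
Proof. by rewrite -{1}(repK a) Sstar_cls ssem_cls. Qed.

(** The action without its domain conditions: a total injection, so that letters cancel freely in
    equations between walks. *)
Definition gact g w : walk G :=
  match g with
  | GenE e => edge_act A e w
  | GenT s i v => shift A (nblk_at A v + i) (sign_int s) w
  end.

Definition wact x w : walk G := foldr gact w x.

Lemma sem_gterm g w' w : sem A (gterm g) w' w <->
  [/\ valid A w, start w = grng g & w' = gact g w].
Proof. by case: g. Qed.

Lemma gact_inj g : injective (gact g).
Proof. by case: g => [e|s i v]; [apply: edge_act_inj|apply: shift_inj]. Qed.

Lemma wact_inj x : injective (wact x).
Proof. by elim: x => [|g x IH] w w' //= /gact_inj/IH. Qed.

Lemma wact_valid x u w : chain x u -> valid A w -> start w = u ->
  valid A (wact x w) /\ start (wact x w) = wsrc x u.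
Proof.
move=> + wv wu; elim: x => [|g x IH] //= [gx /IH[xv xs]].
case: g gx => [e|s i v] /= gx.
  split; first by apply: valid_edge_act; rewrite // xs.
  by apply: start_edge_act; rewrite xs.
split; last by rewrite start_shift xs.
by apply: valid_shift => //; rewrite xs -gx leq_addr.
Qed.

Lemma ssem_word x u w' w : chain x u ->
  ssem (word x u) w' w <-> [/\ valid A w, start w = u & w' = wact x w].
Proof.
elim: x w' => [|g x IH] w'; first by move=> _; apply: ssem_cls.
move=> [gx xu]; rewrite word_cons ssem_mul; split.
  by move=> [z /ssem_cls/sem_gterm[_ _ ->] /(IH _ xu)[wv wu ->]].
move=> [wv wu ->]; have [xv xs] := wact_valid xu wv wu.
exists (wact x w); last exact/IH.
by apply/ssem_cls/sem_gterm; split; rewrite // xs.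
Qed.

Lemma ssem_split x y u w' w : chain x u -> chain y u ->
  ssem (word x u * (word y u)^-*) w' w <->
  exists z, [/\ valid A z, start z = u, w' = wact x z & w = wact y z].
Proof.
move=> xu yu; rewrite ssem_mul; split.
  move=> [z /(ssem_word _ _ xu)[zv zu ->]].
  move=> /ssem_star/(ssem_word _ _ yu)[_ _ ->].
  by exists z.
move=> [z [zv zu -> ->]]; exists z; first exact/ssem_word.
by apply/ssem_star/ssem_word.
Qed.

End Words.

(** * Faithfulness on positive words *)

Section Faithful.
Context (G : sepgraph) (A : adaptable G).
Implicit Types (e f : edge G) (u v : vertex G) (a b : SEC A) (g : gen G).
Implicit Types (x y : seq (gen G)) (w : walk G).

Local Open Scope group_scope.
Local Notation V v := (cls A (Vx v)).
Local Notation E e := (cls A (Ed e)).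
Local Notation Gn g := (cls A (gterm g)).

(** * Depth and coordinates of a walk *)

Fixpoint depth w : nat := if w is Step _ _ w' then (depth w').+1 else 0.

Lemma depth_shift l z w : depth (shift A l z w) = depth w.
Proof. by elim: w l => //= a e w IH l; case: ifP => //= _; rewrite IH. Qed.

Definition nsteps x : nat := count (fun g => ~~ gidx A g) x.

Lemma depth_wact x w : depth (wact A x w) = nsteps x + depth w.
Proof.
elim: x => //= g x IH; case: g => [e|s i v] /=; last by rewrite depth_shift IH.
rewrite /edge_act; case: (kind_of A e) => [i|j|] /=.
- by rewrite depth_shift IH.
- by rewrite IH.
- by rewrite IH.
Qed.

(** Reads the coordinate at the place where [shift] with index l would write. *)
Fixpoint coord l w : int :=
  match w with
  | Halt _ c => c l
  | Step a e w' => if slot A e == Some l then a else coord (pass A e l) w'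
  end.

Lemma coord_shift l l' z w :
  coord l (shift A l' z w) = (coord l w + (if l' == l then z else 0))%R.
Proof.
elim: w l l' => [v c|a e w IH] l l' /=.
  by rewrite eq_sym; case: eqP => _; rewrite ?addr0.
case: (boolP (slot A e == Some l')) => el' /=.
  case: (eqVneq l' l) => [<-|ll']; first by rewrite el'.
  have -> : slot A e == Some l = false.
    apply/negbTE/eqP => el; move: el' ll'; rewrite el => /eqP[->].
    by rewrite eqxx.
  by rewrite addr0.
case: (boolP (slot A e == Some l)) => el.
  by case: eqP => [ll'|_]; rewrite ?addr0 //; move: el'; rewrite ll' el.
(* Past the step the two coordinates agree only if they agreed before, by [pass_inj]. *)
rewrite IH; congr (_ + _)%R.
case: (eqVneq l' l) => [->|ll']; first by rewrite eqxx.
by case: eqP => // /(pass_inj el' el) /eqP; rewrite (negbTE ll').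
Qed.

(** * Words without steps *)

Definition mono g : bool := gidx A g.

Fixpoint expo l x : int :=
  if x is g :: x' then
    ((if gidx A g == Some l then sign_int (gsign g) else 0) + expo l x')%R
  else 0%R.

Lemma coord_wact l x w : all mono x ->
  coord l (wact A x w) = (coord l w + expo l x)%R.
Proof.
elim: x => /= [_|g x IH /andP[gm xm]]; first by rewrite addr0.
have -> : coord l (gact A g (wact A x w)) =
    (coord l (wact A x w) +
     (if gidx A g == Some l then sign_int (gsign g) else 0))%R.
  case: g gm => [e|s i v]; rewrite /mono /=; last by rewrite coord_shift.
  by rewrite /edge_act; case: (kind_of A e) => // i _; rewrite coord_shift.
by rewrite IH // -addrA [(expo l x + _)%R]addrC.
Qed.

Lemma expo_cat l x y : expo l (x ++ y) = (expo l x + expo l y)%R.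
Proof. by elim: x => /= [|g x ->]; rewrite ?add0r ?addrA. Qed.

Lemma expo_sign l s x :
  (forall g, g \in x -> gidx A g = Some l -> gsign g = s) ->
  (0 <= sign_int s * expo l x)%R.
Proof.
elim: x => /= [|g x IH] H; first by rewrite mulr0.
rewrite mulrDr; apply: Num.Theory.addr_ge0.
  case: eqP => [/(H g (mem_head _ _)) ->|_]; last by rewrite mulr0.
  by case: s {H IH}.
by apply: IH => h hx; apply: H; rewrite inE hx orbT.
Qed.

Definition mono_at u g := mono g /\ gsrc g = u.

Lemma mono_rng g : mono g -> grng g = gsrc g.
Proof.
rewrite /mono; case: g => //= e; case ke: (kind_of A e) => // _.
by rewrite (@loop_rng _ A) // /is_loop ke.
Qed.

(** Coordinates below [nblk_at] belong to loops and the others to t's, so vertex, index and sign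
    determine the letter. *)
Lemma mono_inj u g g' : mono_at u g -> mono_at u g' -> gidx A g = gidx A g' ->
  gsign g = gsign g' -> g = g'.
Proof.
move=> [gm <-] [g'm]; case: g gm g'm => [e|s i v]; case: g' => [f|s' i' v'];
  rewrite /mono /=.
- case ke: (kind_of A e) => [i||] // _; case kf: (kind_of A f) => [j||] // _.
  by move=> fe [ij] _; rewrite -ij in kf; rewrite (loop_inj ke kf).
- case ke: (kind_of A e) => [i||] // _ _ -> [il].
  by have := loop_lt ke; rewrite il; lia.
- move=> _; case ke: (kind_of A f) => [j||] // _ <- [il].
  by have := loop_lt ke; rewrite -il; lia.
- by move=> _ _ -> [/addnI->] ->.
Qed.

(** Loops only have sign [Plus], so letters of opposite signs on one coordinate are a t and its
    inverse. *)
Lemma mono_opp u g g' : mono_at u g -> mono_at u g' -> gidx A g = gidx A g' ->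
  gsign g' = opp_sign (gsign g) -> Gn g * Gn g' = V u.
Proof.
move=> [gm <-] [g'm]; case: g gm g'm => [e|s i v]; case: g' => [f|s' i' v'];
  rewrite /mono //=.
- case ke: (kind_of A e) => [i||] // _ _ -> [il].
  by have := loop_lt ke; rewrite il; lia.
- move=> _; case ke: (kind_of A f) => [j||] // _ <- [il].
  by have := loop_lt ke; rewrite -il; lia.
- by move=> _ _ -> [/addnI->] ->; rewrite T_opp.
Qed.

Lemma word_extract u g x y :
  mono_at u g -> (forall h, h \in x -> mono_at u h) ->
  word A (x ++ g :: y) u = Gn g * word A (x ++ y) u.
Proof.
move=> gu; elim: x => // h x IH xu.
rewrite !cat_cons !word_cons IH => [|k kx]; last first.
  by apply: xu; rewrite inE kx orbT.
have [hm hu] := xu h (mem_head _ _); case: gu => gm gu.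
by rewrite !mulgA Gn_comm // hu.
Qed.

(** The letters at u commute. By induction on the total length, the first letter of a nonempty word
    is cancelled against the same letter in the other word or against its inverse in its own. *)
Lemma word_expo_size n u x y : size x + size y <= n ->
  (forall g, g \in x -> mono_at u g) -> (forall g, g \in y -> mono_at u g) ->
  (forall l, expo l x = expo l y) -> word A x u = word A y u.
Proof.
elim: n x y => [|n IH] x y.
  by rewrite leqn0 addn_eq0 !size_eq0 => /andP[/eqP-> /eqP->].
wlog: x y / x != [::] => [H|].
  case: x => [|g x]; last exact: H.
  case: y => [|h y] // sn xu yu xy.
  by apply/esym/H => //; rewrite addnC.
case: x => // g x _ sn xu yu xy.
have gu := xu g (mem_head _ _).
have x'u h : h \in x -> mono_at u h.
  by move=> hx; apply: xu; rewrite inE hx orbT.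
case: (boolP (g \in y)) => [/splitPr yE|gy].
  case: yE sn yu xy => y1 y2 sn yu xy.
  rewrite word_cons word_extract // => [|h hy]; last first.
    by apply: yu; rewrite mem_cat hy.
  congr (_ * _); apply: IH => //.
  - by move: sn; rewrite /= !size_cat /=; lia.
  - move=> h; rewrite mem_cat => hy; apply: yu.
    by rewrite mem_cat inE orbCA hy orbT.
  - move=> l; have := xy l; rewrite /= !expo_cat /= addrCA; exact: addrI.
case gl: (gidx A g) gu => [l|] gu; last by case: gu; rewrite /mono gl.
case: (pselect (exists2 h, h \in x &
    gidx A h = Some l /\ gsign h = opp_sign (gsign g))) => [[h hx [hl hs]]|nh].
  have hu := x'u h hx; case/splitPr: hx sn xu x'u xy => x1 x2 sn xu x'u xy.
  rewrite word_cons word_extract // => [|k kx]; last first.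
    by apply: x'u; rewrite mem_cat kx.
  rewrite mulgA (mono_opp gu hu) ?gl ?hl //.
  have xsrc : wsrc (x1 ++ x2) u = u.
    case E12: (x1 ++ x2) => [//|k s] /=; apply: (x'u k _).2.
    rewrite mem_cat inE orbCA -mem_cat E12 mem_head orbT //.
  rewrite -{1}xsrc word_src; apply: IH => //.
  - by move: sn; rewrite /= !size_cat /=; lia.
  - move=> k; rewrite mem_cat => ky; apply: x'u.
    by rewrite mem_cat inE orbCA ky orbT.
  - move=> m; rewrite -xy /= !expo_cat /= gl hl hs sign_int_opp.
    case: eqP => _; last by rewrite !add0r.
    by rewrite [RHS]addrA [(_ + expo m x1)%R]addrC -addrA addNKr.
(* Otherwise, on coordinate l, all letters of x have the sign of g and all those of y the opposite
   one; so the exponents of g x and y cannot agree. *)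
have xs := @expo_sign l (gsign g) x.
have ys := @expo_sign l (opp_sign (gsign g)) y.
have := xy l; rewrite /= gl eqxx.
have {}xs : (0 <= sign_int (gsign g) * expo l x)%R.
  apply: xs => h hx hl; apply: contrapT => hs; apply: nh; exists h => //.
  by split=> //; case: (gsign h) hs; case: (gsign g).
have {}ys : (0 <= sign_int (opp_sign (gsign g)) * expo l y)%R.
  apply: ys => h hy hl; apply: contrapT => hs.
  move/negP: gy; apply; rewrite (mono_inj gu (yu h hy)) ?gl ?hl //.
  by case: (gsign h) hs; case: (gsign g).
by case: (gsign g) xs ys => /=; lia.
Qed.

(** Letters before the first step are pushed through it and become t's at its range, except the
    loops counted by its slot, which gather in front as a power of one loop f. For n = 0 the letter
    f is a dummy. *)
Lemma step_form x u : chain x u -> nsteps x > 0 -> exists n f e x',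
  [/\ chain x' u, nsteps x = (nsteps x').+1 & ~~ is_loop A e] /\
  [/\ wsrc x u = src e, rng e = wsrc x' u,
      word A x u = word A (nseq n (GenE f) ++ GenE e :: x') u &
      n = 0%N \/ exists i,
        [/\ kind_of A f = Loop i, slot A e = Some i & src f = src e]].
Proof.
elim: x => //= g x IH [gx xu]; case gl: (gidx A g) => [l|] /=; last first.
  move=> _; case: g gx gl => //= e ex el; exists 0%N, e, e, x.
  split; split=> //; last by left.
  by move: el; rewrite /is_loop; case: (kind_of A e).
rewrite add0n => /(IH xu)[n [f [e [x' [[x'u nx eL] [xe ex' xE nf]]]]]].
have gm : mono g by rewrite /mono gl.
have ge : gsrc g = src e by rewrite -mono_rng // gx.
case: (eqVneq (slot A e) (Some l)) => el.
  case: g gx gl gm ge => [h|s i v] /= gx gl gm ge; last first.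
    by case: gl => vl; have := slot_lt el; rewrite -ge; lia.
  case kh: (kind_of A h) gl => [l'||] // -[ll']; rewrite ll' in kh.
  exists n.+1, h, e, x'; split; split=> //; last by right; exists l.
  rewrite -[nseq n.+1 _]/(GenE h :: nseq n (GenE h)) cat_cons !word_cons xE.
  congr (_ * _).
  case: nf => [->//|[i [kf ei fe]]]; congr (word A (nseq n (GenE _) ++ _) u).
  by apply: (loop_inj kf); rewrite ?fe ?ge //; move: ei; rewrite el => -[<-].
(* The letter commutes with the loops collected so far and then passes [e], turning into [t]. *)
set t := GenT (gsign g) (push A e l) (rng e).
suff wE : word A (g :: x) u = word A (nseq n (GenE f) ++ GenE e :: t :: x') u.
  by exists n, f, e, (t :: x'); split; split.
rewrite word_cons xE !word_cat.
have -> : Gn g * prefix_mul (nseq n (GenE f)) (word A (GenE e :: x') u) =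
    prefix_mul (nseq n (GenE f)) (Gn g * word A (GenE e :: x') u).
  case: nf => [->//|[i [kf _ fe]]].
  have gf : Gn g * E f = E f * Gn g.
    by apply: (@Gn_comm _ _ g (GenE f)); rewrite //= ?kf ?ge.
  by elim: n {xE} => //= n IHn; rewrite -IHn !mulgA gf.
congr prefix_mul; rewrite !word_cons !mulgA.
by have [-> _] := push_star gl ge eL el.
Qed.

(** Each loop in front adds one to the exponent of the step, so n and e can be read off the
    image. *)
Lemma wact_steps n f e x w : ~~ is_loop A e ->
  (n = 0%N \/ exists i,
    [/\ kind_of A f = Loop i, slot A e = Some i & src f = src e]) ->
  wact A (nseq n (GenE f) ++ GenE e :: x) w = Step n%:Z e (wact A x w).
Proof.
move=> eL nf; have step0 : wact A (GenE e :: x) w = Step 0%R e (wact A x w).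
  by move: eL; rewrite /= /is_loop /edge_act; case: (kind_of A e).
case: nf => [-> //|[i [kf ei _]]]; elim: n => [//|n IH].
rewrite /= IH /edge_act kf /= ei eqxx; congr (Step _ e _).
by rewrite -natz -[in RHS]natz -natr1.
Qed.

(** On valid walks starting at u the domain conditions hold, and the total action is that of the
    element. *)
Lemma wact_word x y u : chain x u -> chain y u -> word A x u = word A y u ->
  forall w, valid A w -> start w = u -> wact A x w = wact A y w.
Proof.
move=> xu yu xy w wv wu.
have /(@ssem_word _ A _ _ _ _ xu) :
  [/\ valid A w, start w = u & wact A x w = wact A x w] by [].
by rewrite xy => /(@ssem_word _ A _ _ _ _ yu)[].
Qed.

Lemma chain_mono x u : chain x u -> nsteps x = 0%N ->
  forall g, g \in x -> mono_at u g.
Proof.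
move=> + x0; have {x0} : all mono x.
  by move: x0; rewrite /nsteps -[all _ _]negbK -has_predC has_count => ->.
elim: x => //= g x IH /andP[gm xm] [gx xu] h.
have xs : wsrc x u = u.
  case: x IH xm gx xu => //= k x IH xm _ xu.
  by have [] := IH xm xu k (mem_head _ _).
rewrite inE => /orP[/eqP->|]; last exact: IH.
by split=> //; rewrite -mono_rng // gx.
Qed.

(** Induction on the number of steps, which is the growth in depth. Without steps, the coordinates
    give all exponents; otherwise the images of the two normal forms have the same first step, and
    removing it leaves a shorter equation. *)
Lemma wact_faithful x y u w : chain x u -> chain y u ->
  valid A w -> start w = u -> wact A x w = wact A y w ->
  word A x u = word A y u.
Proof.
move=> + + wv wu; move nx: (nsteps x) => n.
elim: n x y nx => [|n IH] x y nx xu yu xy.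
  have ny : nsteps y = 0%N.
    by have := congr1 depth xy; rewrite !depth_wact nx; lia.
  have xm := chain_mono xu nx; have ym := chain_mono yu ny.
  apply: (@word_expo_size _ u x y (leqnn _)) => // l.
  have := congr1 (coord l) xy; rewrite !coord_wact; first exact: addrI.
    by apply/allP => g /ym[].
  by apply/allP => g /xm[].
have ny : nsteps y = n.+1.
  by have := congr1 depth xy; rewrite !depth_wact nx; lia.
have [|k [f [e [x' [[x'u nx' eL] [xe ex' xE kf]]]]]] := step_form xu.
  by rewrite nx.
have [|k' [f' [e' [y' [[y'u ny' e'L] [ye ey' yE kf']]]]]] := step_form yu.
  by rewrite ny.
have chain_step m h d z : chain z u -> rng d = wsrc z u ->
    (m = 0%N \/ exists i,
      [/\ kind_of A h = Loop i, slot A d = Some i & src h = src d]) ->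
    chain (nseq m (GenE h) ++ GenE d :: z) u.
  move=> zu dz [->//|[i [kh _ hd]]]; elim: m => //= m mu; split=> //.
  rewrite (@loop_rng _ A) // ?hd; first by case: (m).
  by rewrite /is_loop kh.
move: xy; rewrite (wact_word xu (chain_step k f e x' x'u ex' kf) xE wv wu).
rewrite (wact_word yu (chain_step k' f' e' y' y'u ey' kf') yE wv wu).
rewrite !wact_steps // => -[kk ee xy']; subst k' e'.
have xy := IH x' y' _ x'u y'u xy'.
rewrite xE yE !word_cat !word_cons xy //; last lia.
congr prefix_mul.
(* For k = 0 there are no loops; otherwise both are the loop at the source of e that its slot
   counts. *)
case: kf kf' => [->//|[i [kf ei fe]]] [->//|[i' [kf' ei' fe']]].
congr (nseq _ (GenE _)); apply: loop_inj kf _ _; last by rewrite fe.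
by move: ei'; rewrite ei => -[->].
Qed.

End Faithful.

(** * From a fixed walk to idempotence *)

Theorem proposition2p19 (G : sepgraph) (A : adaptable G) :
  Estar_unitary (Szero A).
Proof.
move=> s e _ e0 es.
have [//|[x [y [u [xu yu eE]]]]] := split_formP e.
have [s0|[x' [y' [u' [xu' yu' sE]]]]] := split_formP s.
  by case: e0; rewrite es s0 muls0.
(* Halting at once is valid at every vertex, so the factored element e has nonempty domain. *)
have hu : valid A (Halt u (fun=> 0%R)) by [].
pose w := wact A y (Halt u (fun=> 0%R)).
have : ssem e (wact A x (Halt u (fun=> 0%R))) w.
  by rewrite eE; apply/ssem_split => //; exists (Halt u (fun=> 0%R)).
(* As e = e s, the element s relates w to some w' with the same image under e, and injectivity gives
   w' = w. *)
rewrite {1}es => /ssem_mul[w']; rewrite {1}eE.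
move=> /(@ssem_split _ A _ _ _ _ _ xu yu)[z [_ _ /wact_inj <- ->]].
rewrite -/w sE => /(@ssem_split _ A _ _ _ _ _ xu' yu').
move=> [z' [z'v z'u wx wy]].
(* Since s fixes w, its two words send z' to the same walk. *)
have <- : word A x' u' = word A y' u'.
  by apply: wact_faithful z'v z'u _ => //; rewrite -wx.
exact: word_star_idem.
Qed.
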